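(* Let $W$ be a balanced non-periodic word over a finite alphabet $A$. Then there exists a dynamical system $(M,f)$ generating $W$ and satisfying the following conditions (for some positive integer $m$ and some real $\alpha$): \begin{enumerate} \item $M=\mathbb S^1\times\mathbb Z_m$ as a topological space. \item $f:M\to M$ is the composition of the rotation by $\alpha$ on $\mathbb S^1$ and the shift by $1$ on $\mathbb Z_m$. The length of $\mathbb S^1$ equals $m$. \item Each component $\mathbb S^1\times\{k\}$ is divided into $2m$ arcs: $m$ red ones and $m$ blue ones; all red arcs have length $\alpha$, all blue arcs have length $1-\alpha$, and red and blue arcs alternate. \item The blue colour has $l$ hues and the red colour has $k$ hues, where $k+l=|A|$ is the number of letters of the alphabet. The midpoints of all arcs of a given hue (on a component) are the vertices of a regular polygon (a ''regular $1$-gon'' is a point of the circle, a ''regular $2$-gon'' is a pair of diametrically opposite points). \item When passing from the component $\mathbb S^1\times\{k\}$ to the component $\mathbb S^1\times\{k+1\}$ (where $\mathbb S^1\times\{m+1\}=\mathbb S^1\times\{1\}$), the order of the hues within the red arcs and within the blue arcs is preserved, while the red and the blue arcs (two ''roulettes'') are rotated relative to each other by $1$; thus $f$ produces a displacement by $\alpha$ relative to the red arcs and by $1-\alpha$ in the opposite direction relative to the blue arcs. \end{enumerate}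
   Context: $W=(w_n)_{n\in\mathbb Z}$ is a two-sided infinite word. It is balanced if for any two finite subwords $u,v$ of $W$ of equal length and every letter $a\in A$ one has $\bigl||u|_{a}-|v|_{a}\bigr|\le1$, where $|u|_a$ is the number of occurrences of $a$ in $u$. The hues (of both colours together) are in bijection with the letters of $A$; the characteristic set $U_a\subset M$ of a letter $a$ is the union of all arcs, on all components, of the hue corresponding to $a$. The system $(M,f)$ generates $W$ if for some initial point $x\in M$ the word $W$ is the evolution of $x$: $w_n=a$ when $f^{n}(x)\in U_a$. If the trajectory hits boundaries of characteristic sets, evolution is understood as essential evolution: a finite word $v$ is an essential finite evolution of a point $x^*$ if every neighbourhood of $x^*$ contains a nonempty open set all of whose points have evolution $v$; an infinite word is an essential evolution of $x^*$ if each of its initial finite subwords is an essential finite evolution of $x^*$.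
   Formalization: ''Non-periodic'' is taken as: W has no period even outside a finite window (…aaabaaa… is balanced without a period, yet no such system generates it); a hue of a letter that does not occur in W may have no arcs, and the polygon condition is then void for it. *)

(* Defs.v *)
From HB Require Import structures.
From mathcomp Require Import all_boot all_order all_algebra.
From mathcomp Require Import all_classical all_reals topology.
Set Implicit Arguments.
Unset Strict Implicit.
Unset Printing Implicit Defensive.
Import Order.TTheory GRing.Theory Num.Theory numFieldTopology.Exports.
Local Open Scope classical_set_scope.
Local Open Scope ring_scope.
Local Open Scope quotient_scope.

Definition subword (A : Type) (W : int -> A) (i : int) (n : nat) : seq A :=
  mkseq (fun t => W (i + t%:Z)) n.

Definition balanced (A : eqType) (W : int -> A) : Prop :=
  forall (i j : int) (n : nat) (a : A),
    `|(count_mem a (subword W i n))%:Z - (count_mem a (subword W j n))%:Z| <= 1.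

(* Non-periodicity has to exclude words such as ...aaabaaa... (the "skew"
   words): they are balanced and have no period, but agree with a periodic word
   outside of a finite window, and no system considered below generates them.
   A word is therefore called periodic as soon as it has a period outside of
   some finite window. *)
Definition nonperiodic (A : Type) (W : int -> A) : Prop :=
  ~ exists (p N : nat), (0 < p)%N /\
      forall n : int, N%:Z <= `|n| -> W (n + p%:Z) = W n.

(* [iterz f g n] is the n-th iterate of f, n : int, where g is the inverse
   of f. *)
Definition iterz (T : Type) (f g : T -> T) (n : int) : T -> T :=
  match n with
  | Posz n => iter n f
  | Negz n => iter n.+1 g
  end.

Section Evolution.
Variables (M : topologicalType) (f g : M -> M) (A : finType) (U : A -> set M).

Definition boundary (B : set M) : set M := closure B `\` interior B.

Definition hits_boundary (x : M) : Prop :=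
  exists (n : int) (a : A), boundary (U a) (iterz f g n x).

Definition evolution (W : int -> A) (x : M) : Prop :=
  forall (n : int) (a : A), W n = a <-> U a (iterz f g n x).

(* The letters of the finite word v are read at times i, i + 1, ... *)
Definition finite_evolution (i : int) (v : seq A) (x : M) : Prop :=
  forall (t : nat) (a : A), onth v t = Some a -> U a (iterz f g (i + t%:Z) x).

Definition essential_finite_evolution (i : int) (v : seq A) (x : M) : Prop :=
  forall V : set M, nbhs x V ->
    exists O : set M, [/\ open O, O !=set0, O `<=` V &
      forall y, O y -> finite_evolution i v y].

(* The initial finite subwords of a two-sided word are its central windows
   w_{-n} ... w_n. *)
Definition essential_evolution (W : int -> A) (x : M) : Prop :=
  forall n : nat,
    essential_finite_evolution (- n%:Z) (subword W (- n%:Z) n.*2.+1) x.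

Definition generates (W : int -> A) : Prop :=
  exists x : M,
    (~ hits_boundary x /\ evolution W x) \/
    (hits_boundary x /\ essential_evolution W x).

End Evolution.

Section Circle.
Variables (R : realType) (m : nat).

Definition circle_rel (x y : R) : bool := (x - y) / m%:R \is a Num.int.

Lemma circle_rel_refl : reflexive circle_rel.
Proof. by move=> x; rewrite /circle_rel subrr mul0r rpred0. Qed.

Lemma circle_rel_sym : symmetric circle_rel.
Proof. by move=> x y; rewrite /circle_rel -opprB mulNr rpredN. Qed.

Lemma circle_rel_trans : transitive circle_rel.
Proof.
move=> y x z; rewrite /circle_rel => xy yz.
by rewrite -(subrKA y) mulrDl rpredD.
Qed.

Canonical circle_equiv : equiv_rel R :=
  EquivRel circle_rel circle_rel_refl circle_rel_sym circle_rel_trans.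

(* The circle R / mZ, of length m for 0 < m, with the quotient topology. *)
Definition circle : Type := quotient_topology {eq_quot circle_equiv}.
HB.instance Definition _ := Topological.on circle.

Definition circle_pt (x : R) : circle := \pi_{eq_quot circle_equiv} x.

Definition circle_rot (a : R) (p : circle) : circle :=
  circle_pt (repr (p : {eq_quot circle_equiv}) + a).

Lemma circle_ptP (x y : R) :
  circle_pt x = circle_pt y <-> (x - y) / m%:R \is a Num.int.
Proof. by split=> [/eqmodP|h]; last exact/eqmodP. Qed.

Lemma circle_rot_pt (a x : R) : circle_rot a (circle_pt x) = circle_pt (x + a).
Proof.
apply/circle_ptP; rewrite opprD addrACA subrr addr0; apply/circle_ptP.
by rewrite /circle_pt reprK.
Qed.

Lemma circle_rotK (a : R) : cancel (circle_rot a) (circle_rot (- a)).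
Proof.
move=> p; rewrite {2}/circle_rot circle_rot_pt addrK /circle_pt; exact: reprK.
Qed.

(* The arc with starting point p and length len (meaningful for len <= m). It
   is half-open so that arcs can tile the circle; this choice does not affect
   [generates], which deals with orbits through end points by means of open
   sets. *)
Definition circle_arc (p : circle) (len : R) : set circle :=
  [set circle_rot t p | t in [set t : R | 0 <= t < len]].

Definition midpoint (p : circle) (len : R) : circle := circle_rot (len / 2) p.

Definition regular_polygon (S : set circle) : Prop :=
  exists (n : nat) (p : circle), (0 < n)%N /\
    S = [set circle_rot (j%:R * (m%:R / n%:R)) p
           | j in [set j : nat | (j < n)%N]].

Definition phase_space : Type := (circle * discrete_topology 'I_m)%type.
HB.instance Definition _ := Topological.on phase_space.

Definition step (alpha : R) (x : phase_space) : phase_space :=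
  (circle_rot alpha x.1, ordS x.2).

Definition step_inv (alpha : R) (x : phase_space) : phase_space :=
  (circle_rot (- alpha) x.1, ord_pred x.2).

Lemma stepK (alpha : R) : cancel (step alpha) (step_inv alpha).
Proof. by case=> p c; rewrite /step /step_inv /= circle_rotK ordSK. Qed.

Lemma step_invK (alpha : R) : cancel (step_inv alpha) (step alpha).
Proof.
case=> p c; rewrite /step /step_inv /= ord_predK.
by have := circle_rotK (- alpha) p; rewrite opprK => ->.
Qed.

(* On the component c, [red_start c i] is the starting point of the i-th red
   arc and [red_hue c i] its hue; likewise for the blue arcs. *)
Record coloring (k l : nat) : Type := Coloring {
  red_start : 'I_m -> 'I_m -> circle;
  blue_start : 'I_m -> 'I_m -> circle;
  red_hue : 'I_m -> 'I_m -> 'I_k;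
  blue_hue : 'I_m -> 'I_m -> 'I_l
}.

Section Coloring.
Variables (k l : nat) (alpha : R) (C : coloring k l).

Definition red_arc (c i : 'I_m) : set circle :=
  circle_arc (red_start C c i) alpha.

Definition blue_arc (c i : 'I_m) : set circle :=
  circle_arc (blue_start C c i) (1 - alpha).

Definition arc_of (c : 'I_m) (s : 'I_m + 'I_m) : set circle :=
  match s with inl i => red_arc c i | inr i => blue_arc c i end.

(* The i-th red arc is followed by the i-th blue arc, which is followed by the
   (i+1)-st red arc, cyclically. *)
Definition alternating_division : Prop :=
  [/\ 0 < alpha < 1,
      forall (c : 'I_m) (p : circle), exists! s, arc_of c s p,
      forall c i : 'I_m, circle_rot alpha (red_start C c i) = blue_start C c i &
      forall c i : 'I_m,
        circle_rot (1 - alpha) (blue_start C c i) = red_start C c (ordS i)].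

Definition red_midpoints (c : 'I_m) (h : 'I_k) : set circle :=
  [set midpoint (red_start C c i) alpha | i in [set i | red_hue C c i = h]].

Definition blue_midpoints (c : 'I_m) (h : 'I_l) : set circle :=
  [set midpoint (blue_start C c i) (1 - alpha)
     | i in [set i | blue_hue C c i = h]].

(* Only hues that do have arcs are concerned: a letter of the alphabet which
   does not occur in W corresponds to a hue without arcs. The hue of a letter
   which does occur has arcs as soon as the system generates W. *)
Definition polygonal_hues : Prop :=
  (forall (c : 'I_m) (h : 'I_k),
     red_midpoints c h !=set0 -> regular_polygon (red_midpoints c h)) /\
  (forall (c : 'I_m) (h : 'I_l),
     blue_midpoints c h !=set0 -> regular_polygon (blue_midpoints c h)).

(* From a component to the next one the red roulette keeps its place, while
   the blue one is rotated by 1 in the direction of the rotation by alpha. So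
   [step alpha] moves points by alpha relative to the red roulette and by
   alpha - 1 relative to the blue one. *)
Definition rotating_roulettes : Prop :=
  (forall c i : 'I_m,
     red_start C (ordS c) i = red_start C c i /\
     red_hue C (ordS c) i = red_hue C c i) /\
  (forall c i : 'I_m,
     blue_start C (ordS c) (ordS i) = circle_rot 1 (blue_start C c i) /\
     blue_hue C (ordS c) (ordS i) = blue_hue C c i).

Definition char_set (A : Type) (letter : 'I_k + 'I_l -> A) (a : A) :
    set phase_space :=
  [set x : phase_space | exists i : 'I_m,
     (letter (inl (red_hue C x.2 i)) = a /\ red_arc x.2 i x.1) \/
     (letter (inr (blue_hue C x.2 i)) = a /\ blue_arc x.2 i x.1)].

End Coloring.
End Circle.

(* Main.v *)
Require Import Defs.
From mathcomp Require Import all_boot all_order all_algebra.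
From mathcomp Require Import all_classical all_reals topology.
From mathcomp Require Import ring lra zify.
Set Implicit Arguments.
Unset Strict Implicit.
Unset Printing Implicit Defensive.
Import Order.TTheory GRing.Theory Num.Theory numFieldTopology.Exports.
Local Open Scope ring_scope.

(** For a letter [a] let [height W a n] be the signed number of occurrences of [a]
between the times 0 and n. Balance keeps this height within distance 1 below a
line [n * theta a + rho a] ([balanced_tracks]). If all frequencies [theta a]
were rational, [W] would be periodic on both sides outside of a finite window,
so some of them are irrational; a letter with a positive rational frequency
would fill an arithmetic progression, on which an irrational letter cannot avoid
occurring ([rational_frequency_eq0]).

The colours appear when [W] is compared with a shift by [p], where every
irrational [p * theta a] is very close to an integer [q a]. The number of [a]'s
in the window [n, n + p) is [q a], except at rare and isolated times [n], when
it is off by one: above if [p * theta a > q a] (the red letters) and below if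
[p * theta a < q a] (the blue letters). Since the counts add up to [p], a red
and a blue letter are off together; as both were right one step before and are
right again one step later, [W] reads the blue letter and then the red one,
while the shifted word reads them in the opposite order ([atypical_swap]).
So [W] and its shift differ by swaps of adjacent letters of different colours:
the word of the red letters alone has a period, and likewise the blue one. Hence
the frequencies of the letters of one colour are commensurable
([class_proportional]).

Let [alpha] be the total frequency of the red letters. The number of red letters
read before the time [n] is then, with at most one exception for each letter,
[G y] at [y = n * alpha], for a staircase function [G] that is a sum of finitely
many functions [y |-> floor (lam a * y + rho a)], and similarly for a blue
staircase [B] at [n - y]. As the multiples of [alpha] are dense modulo the
periods, [G y + B (j - y) = j] holds for all real [y] and integers [j], up to
one-sided limits ([functional_equation]). Moving [y] and [j] both by 1 leaves the blue part
unchanged, so [G (y + 1) = G y + 1]: the jumps of [G] are single and form one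
coset of the integers, and each red letter owns a residue class of them
([staircase_lattice]). This says that the word of colours is a Sturmian word
whose red letters, and whose blue letters, are distributed with constant gaps
([roulette_decomposition]).

The residue classes are the regular polygons. On the circle of length [m], a
common multiple of all gaps, a point moving by [alpha] passes the integer [i]
exactly when it reads a red letter, which is the one at the place [i] of the red
word; on the component [c], reached at a time congruent to [c], the blue letters
read so far, this time included, are [c + 1 - i] in number modulo [m], whence the
relative rotation of the roulettes. If the line [n * alpha + rho] meets an
integer at some time, every finite part of the word is the evolution of points
close to the starting point on a fixed side of it, so that the word is an
essential evolution ([tracks_window]). *)

(** * Approximation of reals by rationals *)

Section Approximation.
Variable R : realType.
Implicit Types x y beta gamma eta delta : R.

Definition irrational x := forall k : nat, (0 < k)%N -> k%:R * x \isn't a Num.int.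

Lemma common_lower_bound (I : finType) (f : I -> R) :
  (forall i, 0 < f i) -> exists2 eta : R, 0 < eta & forall i, eta <= f i.
Proof.
move=> f0; exists (\big[Num.min/1]_i f i).
  by elim/big_ind: _ => // x y x0 y0; rewrite lt_min x0.
by move=> i; rewrite (bigD1 i) //= ge_min lexx.
Qed.

Lemma distance_to_int_gt0 x : x \isn't a Num.int ->
  exists2 d : R, 0 < d & forall z : int, d <= `|x - z%:~R|.
Proof.
move=> xN; have /andP[fl fu] := floor_itv x.
have fl' : (Num.floor x)%:~R < x.
  rewrite lt_neqAle fl andbT; apply: contra xN => /eqP <-; exact: intr_int.
exists (Num.min (x - (Num.floor x)%:~R) ((Num.floor x + 1)%:~R - x)).
  by rewrite lt_min !subr_gt0 fl'.
move=> z; rewrite ge_min; case: (lerP z%:~R x) => [zx|xz].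
  have : z <= Num.floor x by rewrite floor_ge_int.
  rewrite -(ler_int R) => h; apply/orP; left; lra.
have : Num.floor x + 1 <= z.
  have : Num.floor x < z by rewrite floor_lt_int.
  lia.
rewrite -(ler_int R) => h; apply/orP; right; lra.
Qed.

Lemma bounded_multiples_eq0 x (C : R) : (forall n : nat, n%:R * x <= C) -> x <= 0.
Proof.
move=> h; rewrite leNgt; apply/negP => x0.
have := h (Num.truncn (C / x)).+1.
have := truncnS_gt (C / x); rewrite ltr_pdivrMr // => h1 h2.
by have := lt_le_trans h1 h2; rewrite ltxx.
Qed.

Lemma bounded_multiples_abs_eq0 x (C : R) :
  (forall n : nat, `|n%:R * x| <= C) -> x = 0.
Proof.
move=> h; apply/eqP; rewrite eq_le; apply/andP; split.
  by apply: (@bounded_multiples_eq0 _ C) => n; apply: le_trans (ler_norm _) (h n).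
rewrite -oppr_le0; apply: (@bounded_multiples_eq0 _ C) => n.
by rewrite mulrN; apply: le_trans (ler_norm _) _; rewrite normrN; exact: h.
Qed.

(** Pigeonhole: sort the vectors of fractional parts of [n * theta i] into boxes of
    side [1 / M]; two times in the same box differ by the required [p]. *)
Lemma simultaneous_approximation (I : finType) (theta : I -> R) delta :
  0 < delta ->
  exists (p : nat) (q : I -> int), (0 < p)%N /\
    forall i, `|p%:R * theta i - (q i)%:~R| < delta.
Proof.
move=> d0; pose M := (Num.truncn delta^-1).+1.
have Mgt : delta^-1 < M%:R by exact: truncnS_gt.
have M0 : 0 < M%:R :> R by rewrite ltr0n.
have Md : 1 < M%:R * delta by rewrite -ltr_pdivrMr // mul1r.
pose fr x := x - (Num.floor x)%:~R.
have fr01 x : 0 <= fr x < 1.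
  by rewrite /fr; have := floor_itv x; rewrite intrD; lra.
have bx x : (Num.truncn (M%:R * fr x) < M)%N.
  rewrite truncn_lt_nat; last by rewrite mulr_ge0 ?ler0n //; case/andP: (fr01 x).
  have /andP[_ ?] := fr01 x; by rewrite -[ltRHS]mulr1 ltr_pM2l.
pose box (n : 'I_(#|{ffun I -> 'I_M}|.+1)) : {ffun I -> 'I_M} :=
  [ffun i => Ordinal (bx (n%:R * theta i))].
have /injectivePn[n1 [n2 n12 e]] : ~~ injectiveb box.
  apply/negP => /injectiveP /leq_card; rewrite card_ord ltnn //.
wlog lt12 : n1 n2 n12 e / (n1 < n2)%N.
  move=> H; case: (ltngtP n1 n2) => [||/val_inj] h; first exact: (H n1 n2).
    by apply: (H n2 n1) => //; rewrite eq_sym.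
  by move: n12; rewrite h eqxx.
exists (n2 - n1)%N, (fun i => Num.floor (n2%:R * theta i) - Num.floor (n1%:R * theta i)).
split; first by rewrite subn_gt0.
move=> i; move/ffunP: e => /(_ i); rewrite !ffunE => -[] e.
have := truncn_itv (mulr_ge0 (ler0n R M) (proj1 (andP (fr01 (n1%:R * theta i))))).
have := truncn_itv (mulr_ge0 (ler0n R M) (proj1 (andP (fr01 (n2%:R * theta i))))).
rewrite -e; set t := Num.truncn _.
have -> : t.+1%:R = t%:R + 1 :> R by rewrite natr1.
set T := t%:R.
set f1 := fr _; set f2 := fr _ => /andP[a1 b1] /andP[a2 b2].
have -> : (n2 - n1)%:R * theta i - (Num.floor (n2%:R * theta i) - Num.floor (n1%:R * theta i))%:~R = f1 - f2.
  by rewrite /f1 /f2 /fr natrB 1?ltnW // intrB; ring.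
rewrite ltr_norml; apply/andP; split; rewrite -(ltr_pM2l M0); lra.
Qed.

Lemma irrational_approximation beta delta : irrational beta -> 0 < delta ->
  exists (p : nat) (q : int), (0 < p)%N /\ 0 < `|p%:R * beta - q%:~R| < delta.
Proof.
move=> bN /(@simultaneous_approximation 'I_1 (fun=> beta)) [p [q [p0 /(_ ord0) h]]].
exists p, (q ord0); split=> //; rewrite h andbT normr_gt0 subr_eq0.
by apply/eqP => e; move: (bN p p0); rewrite e intr_int.
Qed.

(** Some multiple of [beta] moves by a nonzero step shorter than [eta] modulo 1, and
    a walk with such steps cannot jump over an interval of length [eta]. *)
Lemma irrational_orbit_dense beta gamma eta : irrational beta -> 0 < eta ->
  exists (n : nat) (z : int), 0 < n%:R * beta + gamma - z%:~R < eta.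
Proof.
move=> bN eta0; have [p [q [p0 /andP[]]]] := irrational_approximation bN eta0.
set eps := _ - _ => e0 elt.
case: (ltrgtP eps 0) e0 elt => [en|ep|->] ; last by rewrite normr0 ltxx.
- rewrite ltr0_norm // => e0 elt.
  (* The steps are negative: walk down from [u > 0] to the last positive value. *)
  pose u := gamma - (Num.floor gamma - 1)%:~R.
  have u0 : 0 < u by rewrite /u intrB; have := floor_le gamma; lra.
  pose i := Num.truncn (u / - eps).
  have/andP[i1 i2] := truncn_itv (divr_ge0 (ltW u0) (ltW e0)).
  have {}i1 : i%:R * - eps <= u by rewrite -ler_pdivlMr.
  have {}i2 : u < i.+1%:R * - eps by rewrite -ltr_pdivrMr.
  move: i2; have -> : i.+1%:R = i%:R + 1 :> R by rewrite natr1.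
  move=> i2.
  have [i1'|i1'] := eqVneq (i%:R * - eps) u.
    have ig : (0 < i)%N by case: (i) i1' => [|//]; rewrite mul0r => h; move: u0; rewrite -h ltxx.
    exists (p * i.-1)%N, (q * i.-1%:Z + (Num.floor gamma - 1)).
    have -> : (p * i.-1)%:R * beta + gamma - (q * i.-1%:Z + (Num.floor gamma - 1))%:~R
      = u + i.-1%:R * eps.
      by rewrite /u /eps; ring.
    have -> : i.-1%:R = i%:R - 1 :> R by rewrite -[in RHS](prednK ig) -natr1 addrK.
    lra.
  exists (p * i)%N, (q * i%:Z + (Num.floor gamma - 1)).
  have -> : (p * i)%:R * beta + gamma - (q * i%:Z + (Num.floor gamma - 1))%:~R
      = u + i%:R * eps.
      by rewrite /u /eps; ring.
  have : i%:R * - eps < u by rewrite lt_neqAle i1'.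
  lra.
- rewrite gtr0_norm // => e0 elt.
  pose u := (Num.floor gamma + 1)%:~R - gamma.
  have u0 : 0 <= u by rewrite /u; have := floorD1_gt gamma; lra.
  pose i := Num.truncn (u / eps).
  have/andP[i1 i2] := truncn_itv (divr_ge0 u0 (ltW e0)).
  have {}i1 : i%:R * eps <= u by rewrite -ler_pdivlMr.
  have {}i2 : u < i.+1%:R * eps by rewrite -ltr_pdivrMr.
  exists (p * i.+1)%N, (q * i.+1%:Z + (Num.floor gamma + 1)).
  have -> : (p * i.+1)%:R * beta + gamma - (q * i.+1%:Z + (Num.floor gamma + 1))%:~R
      = i.+1%:R * eps - u.
      by rewrite /u /eps; ring.
  move: i2; have -> : i.+1%:R = i%:R + 1 :> R by rewrite natr1.
  lra.
Qed.

Lemma irrational_scale (a b : nat) x : (0 < a)%N -> (0 < b)%N ->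
  irrational x -> irrational (a%:R / b%:R * x).
Proof.
move=> a0 b0 xN k k0; apply: contra (xN (k * a)%N _); last by rewrite muln_gt0 k0.
move=> h; have -> : (k * a)%:R * x = (k%:R * (a%:R / b%:R * x)) * b%:R.
  by rewrite natrM; field; rewrite pnatr_eq0 -lt0n.
by rewrite rpredM // rpred_nat.
Qed.

End Approximation.

(** * Slopes of balanced counting functions *)

Section Heights.
Variable R : realType.
Implicit Types (h : int -> int) (theta rho : R).

Lemma sup_between (I J : Type) (i0 : I) (j0 : J) (f : I -> R) (g : J -> R) :
  (forall i j, f i <= g j) ->
  exists s, (forall i, f i <= s) /\ (forall j, s <= g j).
Proof.
move=> fg; exists (sup (range f)); split=> [i|j].
  apply: ub_le_sup; last by exists i.
  by exists (g j0) => _ [k _ <-].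
apply: ge_sup; first by exists (f i0), i0.
by move=> _ [k _ <-].
Qed.

(** Both inequalities are weak: where the line takes an integer value, the height
    may be this integer or its predecessor. This is the only difference between
    lower and upper mechanical words. *)
Definition tracks h theta rho :=
  forall n : int, (h n)%:~R <= n%:~R * theta + rho <= (h n)%:~R + 1.

Definition balanced_height h :=
  forall (i j : int) (n : nat), h (i + n%:Z) - h i <= h (j + n%:Z) - h j + 1.

Lemma le_int_natP (m n : int) : m <= n -> exists k : nat, n = m + k%:Z.
Proof. by move=> mn; exists `|n - m|%N; lia. Qed.

(** A window of length [n * m] is cut into [m] windows of length [n]. *)
Lemma balanced_blocks h : balanced_height h -> forall (i j : int) (n m : nat),
  m%:Z * (h (j + n%:Z) - h j - 1) <= h (i + (n * m)%:Z) - h i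
    <= m%:Z * (h (j + n%:Z) - h j + 1).
Proof.
move=> hb i j n; elim=> [|m /andP[IH1 IH2]].
  by rewrite muln0 addr0 subrr !mul0r lexx.
have -> : i + (n * m.+1)%:Z = i + (n * m)%:Z + n%:Z by lia.
have := hb (i + (n * m)%:Z) j n; have := hb j (i + (n * m)%:Z) n.
have -> : m.+1%:Z = m%:Z + 1 by lia.
rewrite !mulrDl !mul1r; lia.
Qed.

(** The quotients [(count - 1) / length] and [(count + 1) / length], taken over all
    windows, are separated: cut a window of length [n * m] in both ways. Any number
    between the two families is a slope. *)
Lemma balanced_slope h : balanced_height h ->
  exists theta, forall (i : int) (n : nat),
    ((h (i + n%:Z) - h i - 1)%:~R : R) <= n%:R * theta
      <= (h (i + n%:Z) - h i + 1)%:~R.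
Proof.
move=> hb.
pose f (u : int * nat) : R := (h (u.1 + u.2.+1%:Z) - h u.1 - 1)%:~R / u.2.+1%:R.
pose g (u : int * nat) : R := (h (u.1 + u.2.+1%:Z) - h u.1 + 1)%:~R / u.2.+1%:R.
have [|theta [fl gl]] := @sup_between _ _ (0, 0%N) (0, 0%N) f g.
  move=> [i n] [j m]; rewrite /f /g /= ler_pdivrMr // mulrAC ler_pdivlMr //.
  have /andP[h1 _] := balanced_blocks hb 0 i n.+1 m.+1.
  have /andP[_ h2] := balanced_blocks hb 0 j m.+1 n.+1.
  rewrite mulnC in h2; have := le_trans h1 h2.
  by rewrite -(ler_int R) !(intrM _ _%:Z) -!pmulrn mulrC [X in _ <= X]mulrC.
exists theta => i [|n].
  by rewrite addr0 subrr mul0r ltW ?ltrN10 //= ler01.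
have := fl (i, n); have := gl (i, n).
rewrite /f /g /= ler_pdivrMr // ler_pdivlMr // ![theta * _]mulrC.
by move=> -> ->.
Qed.

Lemma balanced_tracks h : balanced_height h -> exists theta rho, tracks h theta rho.
Proof.
move=> /balanced_slope [theta slope].
have [|rho [fl gl]] := @sup_between _ _ (0 : int) (0 : int)
    (fun n => (h n)%:~R - n%:~R * theta) (fun n => (h n)%:~R - n%:~R * theta + 1).
  move=> m n; case: (lerP m n) => [|/ltW] /le_int_natP[k ->].
    have /andP[s1 s2] := slope m k; move: s1 s2.
    rewrite !intrD !mulrDl !mulrNz -pmulrn; lra.
  have /andP[s1 s2] := slope n k; move: s1 s2.
  rewrite !intrD !mulrDl !mulrNz -pmulrn; lra.
exists theta, rho => n; have := fl n; have := gl n; lra.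
Qed.

Lemma monotone_bounded_max (f : int -> int) (C : int) :
  (forall m n, f m - f n <= C) -> exists n0, forall n, f n <= f n0.
Proof.
move=> bnd.
suff H (k : nat) : forall n0, (forall n, f n - f n0 <= k%:Z) ->
    exists n1, forall n, f n <= f n1.
  apply: (H `|C|%N 0) => n; have := bnd n 0; lia.
elim: k => [|k IH] n0 hn0; first by exists n0 => n; have := hn0 n; lia.
have [[n hn]|hN] := pselect (exists n, f n - f n0 = k.+1%:Z).
  by exists n => m; have := hn0 m; lia.
apply: (IH n0) => n; have := hn0 n.
have : f n - f n0 <> k.+1%:Z by move=> e; apply: hN; exists n.
lia.
Qed.

Lemma monotone_le (f : int -> int) : (forall n, f n <= f (n + 1)) ->
  forall m n, m <= n -> f m <= f n.
Proof.
move=> mono m n /le_int_natP[k ->]; elim: k => [|k IH]; first by rewrite addr0.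
apply: (le_trans IH); rewrite -addn1 PoszD addrA; exact: mono.
Qed.

Lemma monotone_bounded_stationary (f : int -> int) (C : int) :
  (forall n, f n <= f (n + 1)) -> (forall m n, f m - f n <= C) ->
  exists N : nat, forall n : int, N%:Z <= `|n| -> f (n + 1) = f n.
Proof.
move=> mono bnd.
have [n1 hn1] := monotone_bounded_max bnd.
have [|n2 hn2] := @monotone_bounded_max (fun n => - f n) C.
  by move=> m n; have := bnd n m; lia.
have le := monotone_le mono.
exists (`|n1| + `|n2|).+1%N => n hn.
have [n0|n0] := lerP 0 n.
  have := hn1 (n + 1); have := le n1 n; have := mono n; lia.
have := hn2 n; have := le (n + 1) n2; have := mono n; lia.
Qed.

(** The sum of [T] consecutive heights, corrected by its mean growth, has the
    increments [h (n + T) - h n - s]. By balance these have a constant sign, and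
    the sum is bounded, so that it is stationary on both sides. *)
Lemma balanced_rational_stationary h theta rho (T : nat) (s : int) :
  balanced_height h -> tracks h theta rho -> T%:R * theta = s%:~R ->
  exists N : nat, forall n : int, N%:Z <= `|n| -> h (n + T%:Z) - h n = s.
Proof.
move=> hb ht Ts.
pose S (n : int) : int := \sum_(t < T) h (n + t%:Z) - n * s.
have SS (n : int) : S (n + 1) - S n = h (n + T%:Z) - h n - s.
  rewrite /S; have -> : \sum_(t < T) h (n + 1 + t%:Z) =
     \sum_(t < T) h (n + t%:Z) + h (n + T%:Z) - h n.
    have : \sum_(t < T.+1) h (n + t%:Z) = \sum_(t < T) h (n + t%:Z) + h (n + T%:Z).
      by rewrite big_ord_recr.
    rewrite big_ord_recl /= addr0 => <-; rewrite [RHS]addrC addKr.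
    by apply: eq_bigr => t _; congr h; rewrite /bump /=; lia.
  by ring.
pose c : R := \sum_(t < T) (t%:R * theta + rho).
have Sc (n : int) : c - T%:R <= (S n)%:~R <= c.
  have -> : (S n)%:~R = \sum_(t < T) ((h (n + t%:Z))%:~R - n%:~R * theta).
    rewrite sumrB sumr_const card_ord -mulr_natl /S intrB intrM -Ts.
    by rewrite (raddf_sum (intr : {additive int -> R})); ring.
  have ht' (t : nat) : t%:R * theta + rho - 1 <= (h (n + t%:Z))%:~R - n%:~R * theta <= t%:R * theta + rho.
    by have := ht (n + t%:Z); rewrite intrD -pmulrn; lra.
  have -> : c - T%:R = \sum_(t < T) (t%:R * theta + rho - 1).
    by rewrite sumrB sumr_const card_ord.
  by apply/andP; split; apply: ler_sum => t _; have /andP[] := ht' t.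
have Sb (m n : int) : S m - S n <= T%:Z.
  rewrite -(ler_int R) intrB -pmulrn; have := Sc m; have := Sc n; lra.
clear Sc; clearbody S.
have [[m zm]|zN] := pselect (exists m : int, h (m + T%:Z) - h m < s).
  have [||N HN] := @monotone_bounded_stationary (fun n => - S n) T%:Z.
  - by move=> n /=; have := SS n; have := hb n m T; lia.
  - by move=> i j /=; have := Sb j i; lia.
  by exists N => n /HN; have := SS n; lia.
have [||N HN] := @monotone_bounded_stationary S T%:Z.
- move=> n; have := SS n; have : ~ (h (n + T%:Z) - h n < s) by move=> e; apply: zN; exists n.
  lia.
- by move=> i j; have := Sb i j; lia.
by exists N => n /HN; have := SS n; lia.
Qed.

End Heights.

(** * Letter counts in windows *)

Section WordHeight.
Variables (A : eqType) (W : int -> A).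
Implicit Type a : A.

(** For negative [n] the occurrences between [n] and 0 count negatively. *)
Definition height a (n : int) : int :=
  match n with
  | Posz k => (\sum_(i < k) (W i%:Z == a))%:Z
  | Negz k => - (\sum_(i < k.+1) (W (Negz i) == a))%:Z
  end.

Lemma heightS a (n : int) : height a (n + 1) = height a n + (W n == a)%:Z.
Proof.
case: n => [k|[|k]].
- by rewrite -PoszD addn1 /= big_ord_recr.
- rewrite /= big_ord0 big_ord_recr big_ord0 /=; lia.
- have -> : Negz k.+1 + 1 = Negz k by lia.
  by rewrite /height [in RHS]big_ord_recr /= PoszD opprD subrK.
Qed.

Lemma count_subword a (i : int) (n : nat) :
  (count_mem a (subword W i n))%:Z = height a (i + n%:Z) - height a i.
Proof.
elim: n => [|n IH]; first by rewrite addr0 subrr.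
have -> : subword W i n.+1 = rcons (subword W i n) (W (i + n%:Z)) by exact: mkseqS.
rewrite -cats1 count_cat PoszD IH /= addn0.
have -> : i + n.+1%:Z = i + n%:Z + 1 by lia.
rewrite heightS; lia.
Qed.

Lemma balanced_height_height a : balanced W -> balanced_height (height a).
Proof. by move=> hb i j n; rewrite -!count_subword; have := hb i j n a; rewrite ler_norml => /andP[]; set x := Posz _; set y := Posz _; lia. Qed.

Lemma height_monotone a (m n : int) : m <= n -> height a m <= height a n.
Proof. by apply: monotone_le => i; rewrite heightS; lia. Qed.

End WordHeight.

Lemma sum_height (A : finType) (W : int -> A) (n : int) :
  \sum_a height W a n = n.
Proof.
have S1 (m : int) : \sum_a height W a (m + 1) = \sum_a height W a m + 1.
  rewrite (eq_bigr _ (fun a _ => heightS W a m)) big_split /=; congr (_ + _).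
  rewrite (bigD1 (W m)) //= eqxx big1 ?addr0 // => a /negPf.
  by rewrite eq_sym => ->.
have S0 : \sum_a height W a 0 = 0 by apply: big1 => a _ /=; rewrite big_ord0.
have Sp (k : nat) : \sum_a height W a k%:Z = k%:Z.
  by elim: k => [//|k IH]; rewrite -addn1 PoszD S1 IH.
case: n => [//|k]; elim: k => [|k IH].
  by have := S1 (Negz 0); rewrite (_ : Negz 0 + 1 = 0) // S0; lia.
by have := S1 (Negz k.+1); rewrite (_ : Negz k.+1 + 1 = Negz k) ?IH; lia.
Qed.

Section Shift.
Variable R : realType.
Implicit Types (h : int -> int) (theta rho : R).

Lemma shift_drift h theta rho (p : nat) (q : int) (n : int) :
  tracks h theta rho -> `|p%:R * theta - q%:~R| < 1 ->
  (0 < p%:R * theta - q%:~R -> 0 <= h (n + p%:Z) - h n - q <= 1) /\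
  (p%:R * theta - q%:~R < 0 -> -1 <= h (n + p%:Z) - h n - q <= 0).
Proof.
move=> ht; rewrite ltr_norml => e1.
have := ht n; have := ht (n + p%:Z); rewrite intrD -pmulrn => t1 t2.
have up (z : int) : ((h (n + p%:Z) - h n - q)%:~R : R) < z%:~R + 1 ->
    h (n + p%:Z) - h n - q <= z.
  by rewrite -[1](_ : 1%:~R = 1) // -intrD ltr_int; lia.
have dn (z : int) : (z%:~R - 1 : R) < (h (n + p%:Z) - h n - q)%:~R ->
    z <= h (n + p%:Z) - h n - q.
  by rewrite -[1](_ : 1%:~R = 1) // -intrB ltr_int; lia.
by split=> e0; apply/andP; split; [apply: dn|apply: up|apply: dn|apply: up];
  rewrite !intrB; lra.
Qed.

(** A window of length [p] can contain a number of letters other than [q] only if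
    the remainder [p * theta - q] carries the line across an integer. Giving the
    interval of such positions by its centre treats both signs at once. *)
Lemma drift_near_int h theta rho (p : nat) (q : int) (n : int) :
  tracks h theta rho -> h (n + p%:Z) - h n != q ->
  exists z : int, `|n%:~R * theta + rho - z%:~R + (p%:R * theta - q%:~R) / 2|
    <= `|p%:R * theta - q%:~R| / 2.
Proof.
move=> ht; have := ht n; have := ht (n + p%:Z); rewrite intrD -pmulrn => t1 t2.
rewrite neq_lt => /orP[lo|hi].
  exists (h n); have : ((h (n + p%:Z))%:~R + 1 : R) <= (h n + q)%:~R.
    by rewrite -[1](_ : 1%:~R = 1) // -intrD ler_int; lia.
  rewrite intrD => h1; rewrite ler_norml ler0_norm; lra.
exists (h n + 1); have : ((h n + q)%:~R + 1 : R) <= (h (n + p%:Z))%:~R.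
  by rewrite -[1](_ : 1%:~R = 1) // -intrD ler_int; lia.
rewrite !intrD => h1; rewrite ler_norml ger0_norm; lra.
Qed.

(** Were both windows wrong, the positions of the line at [n] and [n + k] would lie
    in the same short interval modulo 1, so that [k * theta] would be too close to
    an integer. *)
Lemma drift_isolated h theta rho (p k : nat) (q : int) (n : int) :
  tracks h theta rho ->
  (forall z : int, `|p%:R * theta - q%:~R| < `|k%:R * theta - z%:~R|) ->
  h (n + p%:Z) - h n != q -> h (n + k%:Z + p%:Z) - h (n + k%:Z) = q.
Proof.
move=> ht far /(drift_near_int ht) [z1 h1]; apply/eqP; apply: contraT.
move=> /(drift_near_int ht) [z2 h2]; have := far (z2 - z1).
rewrite ltNge => /negP; case; apply: le_trans (_ : _ <= `|p%:R * theta - q%:~R| / 2 + `|p%:R * theta - q%:~R| / 2) _; last lra.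
apply: le_trans (lerD h2 h1); apply: le_trans (ler_normB _ _).
rewrite le_eqVlt; apply/orP; left; apply/eqP; congr `|_|.
by ring.
Qed.

Lemma tracks_letter (A : eqType) (W : int -> A) a theta rho (n k : int) :
  tracks (height W a) theta rho ->
  k%:~R + 1 - theta < n%:~R * theta + rho < k%:~R + 1 -> W n = a.
Proof.
move=> ht /andP[x1 x2]; apply/eqP; apply: contraT => /negPf Wa.
have := ht (n + 1); have := ht n; rewrite heightS Wa addr0 intrD => t1 t2.
have : (k%:~R : R) < (height W a n)%:~R by lra.
have : ((height W a n)%:~R : R) < (k + 1)%:~R by rewrite intrD; lra.
rewrite !ltr_int; lia.
Qed.

End Shift.

(** * Frequencies of the letters *)

Section Frequencies.
Variables (R : realType) (A : finType) (W : int -> A) (theta rho : A -> R).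
Hypothesis ht : forall a, tracks (height W a) (theta a) (rho a).
Implicit Types a b c : A.

Lemma slope_unique (x y C : R) : (forall n : nat, `|n%:R * x - n%:R * y| <= C) -> x = y.
Proof.
move=> h; apply/eqP; rewrite -subr_eq0; apply/eqP.
by apply: (@bounded_multiples_abs_eq0 _ _ C) => n; rewrite mulrBr.
Qed.

Lemma sum_frequencies : \sum_a theta a = 1.
Proof.
apply: (@slope_unique _ _ (#|A|%:R + `|\sum_a rho a|)) => n.
have -> : n%:R * 1 = \sum_a (height W a n%:Z)%:~R :> R.
  by rewrite mulr1 -(raddf_sum (intr : {additive int -> R})) sum_height.
have -> : n%:R * \sum_a theta a - \sum_a (height W a n%:Z)%:~R =
   \sum_a (n%:R * theta a + rho a - (height W a n%:Z)%:~R) - \sum_a rho a.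
  by rewrite !sumrB big_split /= mulr_sumr addrAC addrK.
apply: le_trans (ler_normB _ _) _; rewrite lerD2r.
apply: le_trans (ler_norm_sum _ _ _) _; rewrite -sumr_const.
apply: ler_sum => a _; have := ht a n%:Z; rewrite ler_norml -pmulrn; lra.
Qed.

Lemma frequency_ge0 a : 0 <= theta a.
Proof.
rewrite -oppr_le0; apply: (@bounded_multiples_eq0 _ _ (rho a - (height W a 0)%:~R)) => n.
have := ht a n%:Z; rewrite -pmulrn => /andP[h1 _].
have := height_monotone W a (isT : (0 : int) <= n%:Z).
rewrite -(ler_int R); have := ht a 0; lra.
Qed.

Lemma frequency0_bounded a (m n : int) : theta a = 0 ->
  height W a m - height W a n <= 1.
Proof.
move=> a0; rewrite -(ler_int R) intrB; have := ht a m; have := ht a n.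
rewrite a0; lra.
Qed.

Lemma not_irrational (x : R) : ~ irrational x ->
  exists k : nat, (0 < k)%N /\ k%:R * x \is a Num.int.
Proof.
move=> xQ; apply: contrapT => h; apply: xQ => k k0.
by apply/negP => hk; apply: h; exists k.
Qed.

Hypothesis hb : balanced W.

Lemma irrational_letter_exists : nonperiodic W -> exists a, irrational (theta a).
Proof.
move=> np; apply: contrapT => noirr; apply: np.
have /choice[k hk] a : exists k : nat, (0 < k)%N /\ k%:R * theta a \is a Num.int.
  by apply: not_irrational => ai; apply: noirr; exists a.
pose T := (\prod_a k a)%N.
have T0 : (0 < T)%N by apply: prodn_gt0 => a; have [] := hk a.
have Ti a : exists s : int, T%:R * theta a = s%:~R.
  apply/intrP; rewrite /T (bigD1 a) //= natrM mulrAC rpredM ?rpred_nat //.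
  by have [] := hk a.
have /choice[N HN] a : exists N : nat, forall n : int, N%:Z <= `|n| ->
    (W (n + T%:Z) == a) = (W n == a).
  have [s Ts] := Ti a.
  have [N HN] := balanced_rational_stationary (balanced_height_height a hb) (ht a) Ts.
  exists N.+1 => n hn; have h1 := HN n; have h2 := HN (n + 1).
  have h3 := heightS W a n; have := heightS W a (n + T%:Z).
  rewrite (_ : n + T%:Z + 1 = n + 1 + T%:Z); last lia.
  case: (W n == a) h3; case: (W (n + T%:Z) == a); lia.
exists T, (\sum_a N a)%N; split=> // n hn.
apply/eqP; rewrite HN // (le_trans _ hn) // lez_nat.
by rewrite (bigD1 (W n)) //= leq_addr.
Qed.

(** With a positive rational frequency, [c] would occupy a whole arithmetic
    progression on the right. The times in this progression at which the line of
    [a] is about to cross an integer exist by density, and there [W] reads [a]. *)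
Lemma rational_frequency_eq0 a c : irrational (theta a) ->
  ~ irrational (theta c) -> theta c = 0.
Proof.
move=> ai /[dup] cQ /not_irrational [k [k0 /intrP[s ks]]].
have [N HN] := balanced_rational_stationary (balanced_height_height c hb) (ht c) ks.
have [//|c0] := eqVneq (theta c) 0; exfalso.
have [n [nN Wn]] : exists n : int, N%:Z <= n /\ W n = c.
  apply: contrapT => noc; move/negP: c0; apply.
  rewrite eq_le frequency_ge0 andbT.
  have hc (j : nat) : height W c (N%:Z + j%:Z) = height W c N%:Z.
    elim: j => [|j IH]; first by rewrite addr0.
    have -> : N%:Z + j.+1%:Z = N%:Z + j%:Z + 1 by lia.
    rewrite heightS IH; case: eqP => [e|_]; last by rewrite addr0.
    by exfalso; apply: noc; exists (N%:Z + j%:Z); split=> //; lia.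
  apply: (@bounded_multiples_eq0 _ _ ((height W c N%:Z)%:~R + 1 - N%:R * theta c - rho c)) => j.
  have := ht c (N%:Z + j%:Z); rewrite hc intrD -!pmulrn; lra.
have Wc (j : nat) : W (n + (j * k)%:Z) = c.
  elim: j => [|j IH]; first by rewrite mul0n addr0.
  have h1 := HN (n + (j * k)%:Z); have h2 := HN (n + (j * k)%:Z + 1).
  have h3 := heightS W c (n + (j * k)%:Z); have := heightS W c (n + (j.+1 * k)%:Z).
  rewrite IH eqxx in h3.
  rewrite (_ : n + (j.+1 * k)%:Z = n + (j * k)%:Z + k%:Z); last lia.
  rewrite (_ : n + (j * k)%:Z + k%:Z + 1 = n + (j * k)%:Z + 1 + k%:Z); last lia.
  case: eqP => //; lia.
have ki : irrational (k%:R * theta a).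
  move=> i i0; rewrite mulrA -natrM; apply: ai; by rewrite muln_gt0 i0.
have a0 : 0 < theta a.
  rewrite lt0r frequency_ge0 andbT; apply/eqP => e.
  by have := ai 1%N isT; rewrite e mulr0 rpred0.
have [j [z jz]] := irrational_orbit_dense (n%:~R * theta a + rho a - (1 - theta a)) ki a0.
have Wa : W (n + (j * k)%:Z) = a.
  apply: (@tracks_letter _ _ _ _ (theta a) (rho a) _ z) => //.
  rewrite intrD -pmulrn natrM; lra.
by apply: cQ; rewrite -(Wc j) Wa.
Qed.

End Frequencies.

(** * The two colours *)

Section Classes.
Variables (R : realType) (A : finType) (W : int -> A) (theta rho : A -> R).
Hypothesis ht : forall a, tracks (height W a) (theta a) (rho a).
Hypothesis hb : balanced W.
Implicit Types a b c : A.
Local Notation h := (height W).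
Local Notation irr a := (irrational (theta a)).

(** The shift is taken so close to the integers that no [k * theta a] with
    [0 < k <= #|A|] is as close; this makes the wrong windows of one letter more
    than [#|A|] apart. *)
Lemma sparse_shift_exists : (exists a, irr a) -> exists (p : nat) (q : A -> int),
  (#|A| < p)%N /\ forall a, irr a ->
    [/\ 0 < q a, `|p%:R * theta a - (q a)%:~R| < 1,
        p%:R * theta a - (q a)%:~R != 0 &
        forall (n : int) (k : nat), (0 < k <= #|A|)%N ->
          h a (n + p%:Z) - h a n != q a ->
          h a (n + k%:Z + p%:Z) - h a (n + k%:Z) = q a].
Proof.
move=> [a0 a0i].
have A0 : (0 < #|A|)%N by apply/card_gt0P; exists a0.
have /choice[f hf] (u : A * 'I_#|A|.+1) : exists d : R, 0 < d /\
    (irr u.1 -> (0 < u.2)%N -> forall z : int, d <= `|u.2%:R * theta u.1 - z%:~R|).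
  have [[ui u0]|h1] := pselect (irr u.1 /\ (0 < u.2)%N).
    by have [d d0 hd] := distance_to_int_gt0 (ui _ u0); exists d.
  by exists 1; split=> // ui u0; exfalso; apply: h1.
have [eta eta0 etaf] := common_lower_bound (fun u => proj1 (hf u)).
have far a (k : nat) : irr a -> (0 < k <= #|A|)%N ->
    forall z : int, eta <= `|k%:R * theta a - z%:~R|.
  move=> ai /andP[k0 kA] z; have kA' : (k < #|A|.+1)%N by [].
  apply: le_trans (etaf (a, Ordinal kA')) _.
  exact: (proj2 (hf (a, Ordinal kA'))).
have d0 : 0 < Num.min eta 1 by rewrite lt_min eta0 ltr01.
have [p [q [p0 pq]]] := simultaneous_approximation theta d0.
have {}pq a : `|p%:R * theta a - (q a)%:~R| < eta /\ `|p%:R * theta a - (q a)%:~R| < 1.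
  by have := pq a; rewrite lt_min => /andP[].
exists p, q; split=> [|a ai].
  rewrite ltnNge; apply/negP => pA.
  have := far a0 p a0i _ (q a0); rewrite p0 pA => /(_ isT).
  by rewrite leNgt (proj1 (pq a0)).
have [pq1 pq2] := pq a; split=> //.
- have := far a 1%N ai _ 0; rewrite A0 mul1r subr0 => /(_ isT).
  have a0' := frequency_ge0 ht a; rewrite ger0_norm // => eth.
  rewrite ltNge; apply/negP => q0.
  have : ((q a)%:~R : R) <= 0 by rewrite lerz0.
  have : theta a <= p%:R * theta a by rewrite ler_peMl // ler1n.
  by move: pq1; rewrite ltr_norml; lra.
- apply/eqP => e; have : p%:R * theta a = (q a)%:~R by apply/eqP; rewrite -subr_eq0 e.
  by move=> e'; have := ai p p0; rewrite e' intr_int.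
- move=> n k kA; apply: drift_isolated; first exact: ht.
  by move=> z; apply: lt_le_trans pq1 _; exact: far.
Qed.

Lemma absent_height c n : (forall m, W m != c) -> h c n = 0.
Proof.
move=> hc; case: n => k /=.
  by rewrite big1 // => i _; rewrite (negPf (hc _)).
by rewrite big1 // => i _; rewrite (negPf (hc _)).
Qed.

Section FixedShift.
Variables (p : nat) (q : A -> int).
Hypothesis pA : (#|A| < p)%N.
Hypothesis pq : forall a, irr a ->
    [/\ 0 < q a, `|p%:R * theta a - (q a)%:~R| < 1,
        p%:R * theta a - (q a)%:~R != 0 &
        forall (n : int) (k : nat), (0 < k <= #|A|)%N ->
          h a (n + p%:Z) - h a n != q a ->
          h a (n + k%:Z + p%:Z) - h a (n + k%:Z) = q a].
Hypothesis hirr : exists a, irr a.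

Definition typical (n : int) := forall a, irr a -> h a (n + p%:Z) - h a n = q a.

(** Each letter spoils at most one of [#|A| + 1] consecutive times. *)
Lemma typical_near (n : int) : exists2 k : nat, (k <= #|A|)%N & typical (n + k%:Z).
Proof.
apply: contrapT => no.
have /choice[f hf] (k : 'I_#|A|.+1) : exists a, irr a /\
    h a (n + k%:Z + p%:Z) - h a (n + k%:Z) != q a.
  apply: contrapT => all; apply: no; exists k; first by rewrite -ltnS ltn_ord.
  move=> a ai; apply/eqP; apply: contraT => h1; exfalso; apply: all; by exists a.
have /injectivePn[i [j ij e]] : ~~ injectiveb f.
  by apply/negP => /injectiveP /leq_card; rewrite card_ord ltnn.
wlog lij : i j ij e / (i < j)%N.
  move=> H; case: (ltngtP i j) => [||/val_inj] l; first exact: (H i j).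
    by apply: (H j i) => //; rewrite eq_sym.
  by move: ij; rewrite l eqxx.
have [ai hi] := hf i; have [_ hj] := hf j; have [_ _ _ iso] := pq ai.
have := iso (n + i%:Z) (j - i)%N _ hi.
have -> : n + i%:Z + (j - i)%:Z = n + j%:Z by lia.
have jA := ltn_ord j; move/eqP: hj; rewrite -e => hj H; apply: hj; apply: H; lia.
Qed.

Lemma sum_increments (n : int) : \sum_a (h a (n + p%:Z) - h a n) = p%:Z.
Proof. rewrite sumrB !sum_height; lia. Qed.

Lemma typical_sum (n : int) : typical n ->
  \sum_(a | `[< irr a >]) q a + \sum_(a | ~~ `[< irr a >]) (h a (n + p%:Z) - h a n)
   = p%:Z.
Proof.
move=> tn; apply: etrans (sum_increments n); rewrite [RHS](bigID (fun a => `[< irr a >])) /=.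
by congr (_ + _); apply: eq_bigr => a /asboolP ai; rewrite tn.
Qed.

(** A letter with frequency 0 occurs at most once. The counts in a typical window
    around this occurrence and in a typical window far to the right have the same
    sum [p], with the same contribution of the irrational letters. *)
Lemma letters_irrational (n : int) : irr (W n).
Proof.
apply: contrapT => nQ.
have [a1 a1i] := hirr.
have /choice[N HN] c : exists N : int, ~ irr c -> forall m : int, h c m <= h c N.
  have [ci|cQ] := pselect (irr c); first by exists 0.
  have c0 := rational_frequency_eq0 ht hb a1i cQ.
  have [N HN] := monotone_bounded_max (fun m k => frequency0_bounded ht m k c0).
  by exists N.
have [k1 _ t1] := typical_near (\sum_c `|N c|%N)%N%:Z.
have [k2 k2A t2] := typical_near (n - #|A|%:Z).
have := etrans (typical_sum t1) (esym (typical_sum t2)) => /addrI.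
rewrite big1.
  move/esym/eqP; rewrite psumr_eq0 => [/allP /(_ (W n))|c _]; last first.
    by rewrite subr_ge0 height_monotone //; lia.
  rewrite mem_index_enum => /(_ isT); have /asboolPn -> := nQ; rewrite implyTb.
  have := heightS W (W n) n; rewrite eqxx.
  have := @height_monotone _ W (W n) (n - #|A|%:Z + k2%:Z) n.
  have := @height_monotone _ W (W n) (n + 1) (n - #|A|%:Z + k2%:Z + p%:Z).
  move=> H1 H2 H3 /eqP; have := H1 ltac:(lia); have := H2 ltac:(lia); lia.
move=> c /asboolPn cQ; apply/eqP; rewrite subr_eq0; apply/eqP.
have Nc (m : int) : N c <= m -> h c m = h c (N c).
  by move=> Nm; apply/eqP; rewrite eq_le HN // height_monotone.
have leN : N c <= (\sum_c `|N c|%N)%N%:Z.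
  by apply: le_trans (lez_abs _) _; rewrite lez_nat (bigD1 c) //= leq_addr.
rewrite !Nc //; lia.
Qed.

(** The red letters: their number in a window of length [p] may exceed [q]. *)
Definition increasing_class : pred A := fun a => `[< irr a >] && (0 < p%:R * theta a - (q a)%:~R).
(** The blue letters: their number in a window of length [p] may fall below [q]. *)
Definition decreasing_class : pred A := fun a => `[< irr a >] && (p%:R * theta a - (q a)%:~R < 0).

Lemma classes_disjoint a : increasing_class a -> ~~ decreasing_class a.
Proof. by move=> /andP[_ /ltW]; rewrite /decreasing_class leNgt => /negPf ->; rewrite andbF. Qed.

Lemma classes_cover a : irr a -> ~~ increasing_class a -> decreasing_class a.
Proof.
rewrite /increasing_class /decreasing_class => ai; have [_ _ e0 _] := pq ai.
by rewrite asboolT //= -leNgt lt_neqAle e0.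
Qed.

Lemma rational_absent a : ~ irr a -> forall n, W n != a.
Proof. by move=> aQ n; apply/eqP => e; apply: aQ; rewrite -e; exact: letters_irrational. Qed.

Lemma sum_drift (n : int) : \sum_(a | `[< irr a >]) (h a (n + p%:Z) - h a n - q a) = 0.
Proof.
have rest m : \sum_(a | ~~ `[< irr a >]) (h a (m + p%:Z) - h a m) = 0.
  by apply: big1 => a /asboolPn /rational_absent aN; rewrite !absent_height ?subrr.
rewrite sumrB; have [k _ t] := typical_near n; have := typical_sum t.
rewrite rest addr0 => ->; have := sum_increments n.
by rewrite (bigID (fun a => `[< irr a >])) /= rest addr0 => ->; rewrite subrr.
Qed.

Lemma sum_eq0_exists_gt0 (V : realDomainType) (P : pred A) (f : A -> V) : \sum_(a | P a) f a = 0 ->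
  (exists2 a, P a & f a != 0) -> exists2 a, P a & 0 < f a.
Proof.
move=> s0 [c Pc fc]; apply: contrapT => no.
have le0 a : P a -> 0 <= - f a.
  by move=> Pa; rewrite oppr_ge0 leNgt; apply/negP => f0; apply: no; exists a.
have := psumr_eq0 (index_enum A) le0.
rewrite sumrN s0 oppr0 eqxx => /esym/allP /(_ c).
by rewrite mem_index_enum Pc implyTb oppr_eq0 (negPf fc) => /(_ isT).
Qed.

(** The deviations sum to 0, so a red and a blue letter deviate together. The red
    one, in excess at [n], must leave the window at the next step, hence is read at
    time [n]; the blue one, missing at [n] only, has just left it. *)
Lemma atypical_swap (n : int) : ~ typical n ->
  increasing_class (W n) /\ decreasing_class (W (n - 1)).
Proof.
move=> nt; pose f a : int := h a (n + p%:Z) - h a n - q a.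
have A0 : (0 < 1 <= #|A|)%N by apply/card_gt0P; exists (W n).
have [c /asboolP ci fc] : exists2 a, `[< irr a >] & f a != 0.
  apply: contrapT => no; apply: nt => a ai; apply/eqP; rewrite -subr_eq0.
  by apply: contraT => fa; exfalso; apply: no; exists a => //; apply/asboolP.
split.
- have [|a /asboolP ai fa] := sum_eq0_exists_gt0 (sum_drift n).
    by exists c => //; apply/asboolP.
  have [_ p1 p2 iso] := pq ai; have [_ hneg] := shift_drift n (ht a) p1.
  have ainc : increasing_class a.
    rewrite /increasing_class asboolT //= lt_neqAle eq_sym p2 leNgt /=.
    by apply/negP => /hneg; move: fa; lia.
  suff -> : W n = a by [].
  have := iso n 1%N A0; have h1 := heightS W a n; have h2 := heightS W a (n + p%:Z).
  rewrite (_ : n + 1%:Z + p%:Z = n + p%:Z + 1); last lia.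
  rewrite h2 h1; case: (W n =P a) => // _; case: (_ == a); move: fa; lia.
- have [||b /asboolP bi fb] := @sum_eq0_exists_gt0 int (fun a => `[< irr a >]) (fun a => - f a).
  + by rewrite sumrN sum_drift oppr0.
  + by exists c; [apply/asboolP|rewrite oppr_eq0].
  have [_ p1 p2 iso] := pq bi; have [hpos _] := shift_drift n (ht b) p1.
  have bdec : decreasing_class b.
    rewrite /decreasing_class asboolT //= lt_neqAle p2 leNgt /=.
    by apply/negP => /hpos; move: fb; rewrite /f; lia.
  suff -> : W (n - 1) = b by [].
  have := iso (n - 1) 1%N A0; have h1 := heightS W b (n - 1).
  have h2 := heightS W b (n - 1 + p%:Z); rewrite subrK in h1.
  rewrite (_ : n - 1 + p%:Z + 1 = n + p%:Z) in h2; last lia.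
  rewrite (_ : n - 1 + 1%:Z + p%:Z = n + p%:Z); last lia.
  rewrite (_ : n - 1 + 1%:Z = n); last lia.
  move: fb; rewrite /f h2 h1; case: (W (n - 1) =P b) => // _; case: (_ == b);
    case: eqP; lia.
Qed.

(** An atypical time [n] is preceded by the reading of a blue letter, which changes
    no red height; and [n - 1] is typical, since atypical times read red letters. *)
Lemma increasing_return (n : int) : exists n' : int, typical n' /\
  forall a, increasing_class a -> h a n' = h a n.
Proof.
have [tn|ntn] := pselect (typical n); first by exists n.
have [_ dec] := atypical_swap ntn.
exists (n - 1); split.
  by apply: contrapT => /atypical_swap [/classes_disjoint]; rewrite dec.
move=> a ainc; have := heightS W a (n - 1); rewrite subrK => ->.
case: eqP => [e|_]; last by rewrite addr0.
by move: (classes_disjoint ainc); rewrite -e dec.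
Qed.

Lemma decreasing_return (n : int) : exists n' : int, typical n' /\
  forall a, decreasing_class a -> h a n' = h a n.
Proof.
have [tn|ntn] := pselect (typical n); first by exists n.
have [inc _] := atypical_swap ntn.
exists (n + 1); split.
  apply: contrapT => /atypical_swap [_]; rewrite addrK => /(elimT idP) dec.
  by move: (classes_disjoint inc); rewrite dec.
move=> a adec; rewrite heightS; case: eqP => [e|_]; last by rewrite addr0.
by move: (classes_disjoint inc); rewrite e adec.
Qed.

(** Alternating shifts by [p] with returns to typical times, one reaches times at
    which every height of the class has grown by exactly [i * q]: the growth rates
    of two letters of the class are as their [q]'s. *)
Lemma class_proportional (S : pred A) : (forall a, S a -> irr a) ->
  (forall n : int, exists n' : int, typical n' /\ forall a, S a -> h a n' = h a n) ->
  forall a b, S a -> S b -> (q a)%:~R * theta b = (q b)%:~R * theta a.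
Proof.
move=> Si ret a b Sa Sb; have [n0 [t0 _]] := ret 0.
have orbit (i : nat) : exists n : int, typical n /\
    forall c, S c -> h c n = h c n0 + i%:Z * q c.
  elim: i => [|i [n [tn hn]]].
    by exists n0; split=> // c _; rewrite mul0r addr0.
  have [n' [tn' hn']] := ret (n + p%:Z); exists n'; split=> // c Sc.
  rewrite hn' // -[LHS](subrK (h c n)) tn ?hn //; last exact: Si.
  by rewrite -addn1 PoszD mulrDl mul1r; lia.
pose K := theta b * (rho a - (h a n0)%:~R) - theta a * (rho b - (h b n0)%:~R).
apply: (@slope_unique _ _ _ (`|K| + (theta a + theta b))) => i.
have [n [tn hn]] := orbit i.
have := ht a n; have := ht b n; rewrite !hn // !intrD !intrM -!pmulrn.
set x := n%:~R; set ha := (h a n0)%:~R; set hb' := (h b n0)%:~R.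
move=> /andP[b1 b2] /andP[a1 a2].
have -> : i%:R * ((q a)%:~R * theta b) - i%:R * ((q b)%:~R * theta a) =
  K + (theta a * (x * theta b + rho b - (hb' + i%:R * (q b)%:~R))
     - theta b * (x * theta a + rho a - (ha + i%:R * (q a)%:~R))).
  by rewrite /K -/ha -/hb'; ring.
apply: le_trans (ler_normD _ _) _; rewrite lerD2l.
have ta := frequency_ge0 ht a; have tb := frequency_ge0 ht b.
have {}b1 : 0 <= theta a * (x * theta b + rho b - (hb' + i%:R * (q b)%:~R)) <= theta a.
  by apply/andP; split; [rewrite mulr_ge0 // subr_ge0|rewrite ler_piMr //; lra].
have {}a1 : 0 <= theta b * (x * theta a + rho a - (ha + i%:R * (q a)%:~R)) <= theta b.
  by apply/andP; split; [rewrite mulr_ge0 // subr_ge0|rewrite ler_piMr //; lra].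
by rewrite ler_norml; lra.
Qed.

End FixedShift.
End Classes.

(** * Staircases and residue classes *)

Section Walls.
Variables (R : realType) (A : finType) (S : pred A) (lam rho : A -> R).
Implicit Types (a b : A) (x y : R).

(** Up to a constant, counts the walls up to [y], where a wall of [a] is a point at which
    [lam a * y + rho a] is an integer. *)
Definition staircase y : int := \sum_(a | S a) Num.floor (lam a * y + rho a).

Hypothesis lam0 : forall a, S a -> 0 < lam a.
Hypothesis S_nonempty : exists a, S a.
Hypothesis staircase_step : forall y, staircase (y + 1) = staircase y + 1.

Lemma staircase_le x y : x <= y -> staircase x <= staircase y.
Proof.
move=> xy; apply: ler_sum => a Sa; apply: le_floor.
by rewrite lerD2r ler_pM2l // lam0.
Qed.

Lemma staircase_wall a w y : S a -> lam a * w + rho a \is a Num.int -> y < w ->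
  staircase y < staircase w.
Proof.
move=> Sa /floorK wz yw; rewrite /staircase (bigD1 a) //= [ltRHS](bigD1 a) //=.
apply: ltr_leD.
  by rewrite floor_lt_int wz ltrD2r ltr_pM2l // lam0.
apply: ler_sum => b /andP[Sb _]; apply: le_floor.
by rewrite lerD2r ler_pM2l ?lam0 // ltW.
Qed.

Lemma staircaseD (k : int) y : staircase (y + k%:~R) = staircase y + k.
Proof.
have pos (n : nat) x : staircase (x + n%:R) = staircase x + n%:Z.
  elim: n => [|n IH]; first by rewrite !addr0.
  by rewrite -[in LHS]natr1 addrA staircase_step IH -addn1 PoszD addrA.
case: k => n; first exact: pos.
have := pos n.+1 (y + (Negz n)%:~R).
have -> : (Negz n)%:~R = - n.+1%:R :> R by rewrite NegzE mulrNz.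
rewrite subrK => ->; rewrite NegzE; lia.
Qed.

(** A wall at [w] brings a jump at [w] and, by [staircase_step], one at [w + 1].
    Between them there is only room for a total growth of 1, so that the staircase
    is flat there. All walls thus lie in one coset of the integers; as the walls of
    one letter have the period [1 / lam a], this number is an integer. *)
Lemma staircase_lattice : exists (r : R) (d : A -> nat) (j : A -> int),
  (forall a, S a -> [/\ (0 < d a)%N, lam a = (d a)%:R^-1 &
                        rho a = (r + (j a)%:~R) / (d a)%:R]) /\
  (forall y, staircase y = Num.floor (y + r)).
Proof.
have [a0 Sa0] := S_nonempty; have l0 := lam0 Sa0.
pose w := - rho a0 / lam a0; pose r := (staircase w)%:~R - w.
have wint : lam a0 * w + rho a0 \is a Num.int.
  by rewrite /w mulrCA divff ?gt_eqF // mulr1 addNr rpred0.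
have flat y : w <= y < w + 1 -> staircase y = staircase w.
  move=> /andP[wy yw]; apply/eqP; rewrite eq_le andbC (staircase_le wy) /=.
  have : staircase (y - 1) < staircase w by apply: (staircase_wall Sa0 wint); lra.
  have := staircase_step (y - 1); rewrite subrK; lia.
have fl y : staircase y = Num.floor (y + r).
  set k := Num.floor (y - w); have := floor_itv (y - w); rewrite -/k intrD => kb.
  have := staircaseD k (y - k%:~R); rewrite subrK => ->.
  rewrite flat; last lra.
  apply/esym/floor_def; rewrite /r !intrD; lra.
have wall a x : S a -> lam a * x + rho a \is a Num.int -> x + r \is a Num.int.
  move=> Sa xi; rewrite intrEfloor eq_le floor_le /= leNgt; apply/negP => lt.
  have := @staircase_wall a x ((Num.floor (x + r))%:~R - r) Sa xi.
  by rewrite !fl subrK intrKfloor ltxx => /(_ ltac:(lra)).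
have /choice[u hu] a : exists u : nat * int, S a -> [/\ (0 < u.1)%N,
     lam a = u.1%:R^-1 & rho a = (r + u.2%:~R) / u.1%:R].
  have [Sa|] := pselect (S a); last by exists (0%N, 0).
  have la := lam0 Sa; have la' : lam a != 0 by rewrite gt_eqF.
  have /(wall a) : lam a * ((0 - rho a) / lam a) + rho a \is a Num.int.
    by rewrite mulrCA divff // mulr1 subrK rpred0.
  have /(wall a) : lam a * ((1 - rho a) / lam a) + rho a \is a Num.int.
    by rewrite mulrCA divff // mulr1 subrK rpred1.
  move=> /(_ Sa) i1 /(_ Sa) /[dup] i0 /intrP[z hz].
  have := rpredB i1 i0.
  have -> : (1 - rho a) / lam a + r - ((0 - rho a) / lam a + r) = (lam a)^-1.
    by field.
  move=> /intrP[d hd]; have d0 : 0 < d.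
    by rewrite -(ltr_int R) -hd invr_gt0.
  have dE : `|d|%:R = (lam a)^-1 by rewrite hd pmulrn gez0_abs // ltW.
  exists (`|d|%N, - z) => _ /=; rewrite dE invrK; split=> //; first lia.
  by rewrite mulrNz -hz; field.
exists r, (fun a => (u a).1), (fun a => (u a).2); split=> // a; exact: hu.
Qed.

End Walls.

Lemma floor_ratio (R : realType) (i : int) (d : nat) : (0 < d)%N ->
  Num.floor (i%:~R / d%:R : R) = (i %/ d%:Z)%Z.
Proof.
move=> d0; have d0R : 0 < d%:R :> R by rewrite ltr0n.
apply: floor_def; rewrite ler_pdivlMr // ltr_pdivrMr // pmulrn -!intrM.
rewrite ler_int ltr_int; have := divz_eq i d; have := modz_ge0 i (_ : d%:Z != 0).
have := ltz_mod i (_ : d%:Z != 0); have d0' : d%:Z != 0 by rewrite -lt0n.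
move=> /(_ d0') + /(_ d0'); lia.
Qed.

Lemma divz_step (i : int) (d : nat) : (0 < d)%N ->
  (i %/ d%:Z)%Z - ((i - 1) %/ d%:Z)%Z = (d%:Z %| i)%Z.
Proof.
move=> d0; have d0' : d%:Z != 0 by rewrite -lt0n.
have e1 := divz_eq i d; have e2 := divz_eq (i - 1) d.
have m1 := modz_ge0 i d0'; have m2 := modz_ge0 (i - 1) d0'.
have l1 := ltz_mod i d0'; have l2 := ltz_mod (i - 1) d0'.
have -> : (d%:Z %| i)%Z = ((i %% d)%Z == 0) by apply/idP/eqP => /dvdz_mod0P.
nia.
Qed.

Section ResidueClasses.
Variables (R : realType) (A : finType) (S : pred A) (r : R) (d : A -> nat) (j : A -> int).
Variables (lam rho : A -> R).
Hypothesis dS : forall a, S a -> [/\ (0 < d a)%N, lam a = (d a)%:R^-1 &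
                        rho a = (r + (j a)%:~R) / (d a)%:R].
Hypothesis stair : forall y, staircase S lam rho y = Num.floor (y + r).

(** The staircase grows by 1 at each integer wall, and the jump of the letter [a] at
    [i] is the increment of [(i + j a) %/ d a]. *)
Lemma residue_classes_count (i : int) :
  \sum_(a | S a) ((d a)%:Z %| i + j a)%Z%:Z = 1.
Proof.
have st (k : int) : \sum_(a | S a) ((k + j a) %/ (d a)%:Z)%Z = k.
  have := stair (k%:~R - r); rewrite subrK intrKfloor => {2}<-.
  apply: eq_bigr => a /dS [d0 -> ->]; rewrite -(floor_ratio R) //.
  by congr Num.floor; rewrite intrD; ring.
have <- : \sum_(a | S a) ((i + j a) %/ (d a)%:Z)%Z
    - \sum_(a | S a) ((i - 1 + j a) %/ (d a)%:Z)%Z = 1 by rewrite !st; lia.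
rewrite -sumrB; apply: eq_bigr => a /dS [d0 _ _].
by rewrite -divz_step // addrAC.
Qed.

Lemma residue_class_unique (i : int) a b : S a -> S b ->
  ((d a)%:Z %| i + j a)%Z -> ((d b)%:Z %| i + j b)%Z -> a = b.
Proof.
move=> Sa Sb da db; apply/eqP; apply: contraT => ab.
have := residue_classes_count i; rewrite (bigD1 a) //= (bigD1 b) /=; last first.
  by rewrite Sb eq_sym.
rewrite da db; set s := \sum_(_ | _) _; have : 0 <= s by apply: sumr_ge0.
lia.
Qed.

Lemma residue_class_exists (i : int) : exists2 a, S a & ((d a)%:Z %| i + j a)%Z.
Proof.
apply: contrapT => no; have := residue_classes_count i; rewrite big1 // => a Sa.
by case: (boolP (_ %| _)%Z) => // da; exfalso; apply: no; exists a.
Qed.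

End ResidueClasses.

(** * The functional equation *)

Section FunctionalEquation.
Variables (R : realType) (A : finType) (h : A -> int -> int) (theta rho : A -> R).
Hypothesis ht : forall a, tracks (h a) (theta a) (rho a).
Variables (S S' : pred A) (q : A -> int) (Q Q' : int) (Theta : R) (lam : A -> R).
Hypothesis disj : forall a, S a -> ~~ S' a.
Hypothesis hsum : forall n : int, \sum_(a | S a) h a n + \sum_(a | S' a) h a n = n.
Hypothesis Theta_irr : irrational Theta.
Hypothesis Q0 : 0 < Q.
Hypothesis Q'0 : 0 < Q'.
Hypothesis QS : \sum_(a | S a) q a = Q.
Hypothesis QS' : \sum_(a | S' a) q a = Q'.
Hypothesis lamS : forall a, S a -> lam a * Q%:~R = (q a)%:~R.
Hypothesis lamS' : forall a, S' a -> lam a * Q'%:~R = (q a)%:~R.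
Hypothesis lam0 : forall a, S a || S' a -> 0 < lam a.
Hypothesis thetaS : forall a, S a -> theta a = lam a * Theta.
Hypothesis thetaS' : forall a, S' a -> theta a = lam a * (1 - Theta).

(** By density there is a time [n], congruent to [j] modulo [Q'], at which
    [n * Theta] is congruent modulo [Q * Q'] to a number just above [y]. Then the
    heights of the first class are, up to multiples of the periods, the terms of
    the staircase at [y], and those of the second one are the limits of
    [floor (lam b * w + rho b)] as [w] increases to [j - y]; all of them sum to
    [n]. *)
Lemma functional_equation (y : R) (j : int) :
  staircase S lam rho y
  + \sum_(b | S' b) (Num.ceil (lam b * (j%:~R - y) + rho b) - 1) = j.
Proof.
pose k a := Num.floor (lam a * y + rho a).
pose c b := Num.ceil (lam b * (j%:~R - y) + rho b).
have kb a : (k a)%:~R <= lam a * y + rho a < (k a)%:~R + 1.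
  by have := floor_itv (lam a * y + rho a); rewrite intrD.
have cb b : (c b)%:~R - 1 < lam b * (j%:~R - y) + rho b <= (c b)%:~R.
  by have := ceil_itv (lam b * (j%:~R - y) + rho b); rewrite intrB.
pose f a : R := if S a then ((k a)%:~R + 1 - (lam a * y + rho a)) / lam a
  else if S' a then (lam a * (j%:~R - y) + rho a - ((c a)%:~R - 1)) / lam a else 1.
have f0 a : 0 < f a.
  rewrite /f; case: ifP => Sa; last case: ifP => // Sa'.
    by rewrite divr_gt0 ?lam0 ?Sa // subr_gt0; have /andP[] := kb a.
  by rewrite divr_gt0 ?lam0 ?Sa' ?orbT // subr_gt0; have /andP[] := cb a.
(* To the right of [y], and within [eta], no summand meets an integer. *)
have [eta eta0 etaf] := common_lower_bound f0.
have QR : 0 < Q%:~R :> R by rewrite ltr0z.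
have QR' : 0 < Q'%:~R :> R by rewrite ltr0z.
have [l [z]] : exists (l : nat) (z : int),
    y < (j + Q' * l%:Z)%:~R * Theta - (Q * Q' * z)%:~R < y + eta.
  have b_irr : irrational (Theta / Q%:~R).
    have := @irrational_scale R 1 `|Q|%N Theta isT _ Theta_irr.
    rewrite absz_gt0 gt_eqF // => /(_ isT).
    by rewrite mulrC mul1r pmulrn gez0_abs // ltW.
  have eta0' : 0 < eta / (Q%:~R * Q'%:~R) by rewrite divr_gt0 ?mulr_gt0.
  have [l [z lz]] := irrational_orbit_dense
    ((j%:~R * Theta - y) / (Q%:~R * Q'%:~R)) b_irr eta0'.
  exists l, z; move: lz; rewrite ltr_pdivlMr ?mulr_gt0 //.
  have QQ : 0 < Q%:~R * Q'%:~R :> R by rewrite mulr_gt0.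
  rewrite -(pmulr_lgt0 _ QQ).
  have -> : (l%:R * (Theta / Q%:~R) + (j%:~R * Theta - y) / (Q%:~R * Q'%:~R) - z%:~R) * (Q%:~R * Q'%:~R)
    = (j + Q' * l%:Z)%:~R * Theta - (Q * Q' * z)%:~R - y.
    by rewrite !intrD !intrM -pmulrn; field; rewrite !gt_eqF.
  lra.
set u := _ - _ => /andP[u1 u2].
pose n := j + Q' * l%:Z.
have uE : n%:~R * Theta = u + (Q * Q' * z)%:~R by rewrite /u subrK.
have hS a : S a -> h a n = k a + q a * Q' * z.
  move=> Sa; have la : 0 < lam a by rewrite lam0 ?Sa.
  have := etaf a; rewrite /f Sa ler_pdivlMr // => e1.
  have lu1 : lam a * y < lam a * u by rewrite ltr_pM2l.
  have lu2 : lam a * u < lam a * y + eta * lam a by rewrite [eta * _]mulrC -mulrDr ltr_pM2l.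
  have := ht a n; rewrite (thetaS Sa) mulrCA uE.
  have -> : lam a * (u + (Q * Q' * z)%:~R) = lam a * u + (q a * Q' * z)%:~R.
    by rewrite !intrM -(lamS Sa); ring.
  have := kb a => k1 h1.
  have : ((h a n)%:~R : R) < (k a + q a * Q' * z + 1)%:~R by rewrite 2!intrD; lra.
  have : ((k a + q a * Q' * z)%:~R : R) < (h a n + 1)%:~R by rewrite 2!intrD; lra.
  by rewrite !ltr_int !ltzD1 => le1 le2; apply/eqP; rewrite eq_le le1 le2.
have hS' b : S' b -> h b n = c b - 1 + q b * (l%:Z - Q * z).
  move=> Sb; have lb : 0 < lam b by rewrite lam0 ?Sb ?orbT.
  have Sb0 : S b = false by apply/negP => /disj; rewrite Sb.
  have := etaf b; rewrite /f Sb0 Sb ler_pdivlMr // => e1.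
  have lu1 : lam b * y < lam b * u by rewrite ltr_pM2l.
  have lu2 : lam b * u < lam b * y + eta * lam b by rewrite [eta * _]mulrC -mulrDr ltr_pM2l.
  have := ht b n; rewrite (thetaS' Sb).
  have -> : n%:~R * (lam b * (1 - Theta)) = lam b * (j%:~R - u) + (q b * (l%:Z - Q * z))%:~R.
    have -> : n%:~R * (lam b * (1 - Theta)) = lam b * (n%:~R - n%:~R * Theta) by ring.
    rewrite uE !intrM -(lamS' Sb) /n; ring.
  have := cb b => k1 h1.
  have : ((h b n)%:~R : R) < (c b - 1 + q b * (l%:Z - Q * z) + 1)%:~R by rewrite 3!intrD; lra.
  have : ((c b - 1 + q b * (l%:Z - Q * z))%:~R : R) < (h b n + 1)%:~R by rewrite 3!intrD; lra.
  by rewrite !ltr_int !ltzD1 => le1 le2; apply/eqP; rewrite eq_le le1 le2.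
have := hsum n; rewrite (eq_bigr _ hS) [X in _ + X](eq_bigr _ hS').
rewrite big_split [X in _ + X]big_split /= -!mulr_suml QS QS' /n.
rewrite -[staircase _ _ _ _]/(\sum_(a | S a) k a).
rewrite -[X in _ + X = j]/(\sum_(b | S' b) (c b - 1)).
move: (\sum_(a | S a) k a) (\sum_(b | S' b) (c b - 1)) => s1 s2 e.
have -> : s1 + s2 = s1 + Q * Q' * z + (s2 + Q' * (l%:Z - Q * z)) - Q' * l%:Z by ring.
by rewrite e addrK.
Qed.

(** The second class contributes the same for [y], 0 and for [y + 1], 1. *)
Lemma staircase_shift (y : R) :
  staircase S lam rho (y + 1) = staircase S lam rho y + 1.
Proof.
have e1 := functional_equation (y + 1) 1; have e0 := functional_equation y 0.
have : 1%:~R - (y + 1) = 0%:~R - y :> R by rewrite opprD addrCA subrr addr0 add0r.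
move=> e; rewrite e in e1; lia.
Qed.

End FunctionalEquation.

(** * Structure of balanced words *)

Lemma irrational_compl (R : realType) (x : R) : irrational x -> irrational (1 - x).
Proof.
move=> xi k k0; apply: contra (xi k k0) => h.
have -> : k%:R * x = k%:R - k%:R * (1 - x) by ring.
by rewrite rpredB // rpred_nat.
Qed.

Lemma irrational_int_once (R : realType) (theta rho : R) (m n : int) :
  irrational theta -> m%:~R * theta + rho \is a Num.int ->
  n%:~R * theta + rho \is a Num.int -> m = n.
Proof.
move=> ti mi ni; wlog : m n mi ni / m <= n.
  by move=> H; case: (lerP m n) => [|/ltW] l; [apply: H|apply/esym/H].
move=> /le_int_natP[[|k] nk]; first by rewrite nk addr0.
have := rpredB ni mi.
have -> : n%:~R * theta + rho - (m%:~R * theta + rho) = k.+1%:R * theta.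
  by rewrite nk intrD -pmulrn; ring.
by rewrite (negPf (ti _ _)).
Qed.

Lemma tracks_floor (R : realType) (h : int -> int) (theta rho : R) (n : int) :
  tracks h theta rho -> n%:~R * theta + rho \isn't a Num.int ->
  h n = Num.floor (n%:~R * theta + rho).
Proof.
move=> ht xN; apply/esym/floor_def; have /andP[-> h2] := ht n.
rewrite intrD lt_neqAle h2 andbT; apply: contra xN => /eqP ->.
by rewrite rpredD // intr_int.
Qed.

(** The letters of [S] partition the integers into residue classes, [a] occupying
    the places [i] with [d a] dividing [i + j a]. *)
Definition constant_gaps (A : Type) (S : pred A) (d : A -> nat) (j : A -> int) :=
  [/\ forall a, S a -> (0 < d a)%N,
      forall i : int, exists2 a, S a & ((d a)%:Z %| i + j a)%Z &
      forall (i : int) a b, S a -> S b ->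
        ((d a)%:Z %| i + j a)%Z -> ((d b)%:Z %| i + j b)%Z -> a = b].

Section ClassStructure.
Variables (R : realType) (A : finType) (W : int -> A) (theta rho : A -> R).
Local Notation h := (height W).
Hypothesis ht : forall a, tracks (h a) (theta a) (rho a).
Variables (S : pred A) (lam : A -> R) (Theta : R).
Hypothesis Theta_irr : irrational Theta.
Hypothesis Theta01 : 0 < Theta < 1.
Hypothesis thetaS : forall a, S a -> theta a = lam a * Theta.

Definition class_height (n : int) : int := \sum_(a | S a) h a n.

Lemma class_heightS (n : int) : class_height (n + 1) = class_height n + (S (W n))%:Z.
Proof.
rewrite /class_height (eq_bigr _ (fun a _ => heightS W a n)) big_split /=.
congr (_ + _); case: (boolP (S (W n))) => SW.
  rewrite (bigD1 (W n)) //= eqxx big1 ?addr0 // => a /andP[_ /negPf].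
  by rewrite eq_sym => ->.
rewrite big1 // => a Sa; case: eqP => // e; by move: SW; rewrite e Sa.
Qed.

Variables (r : R) (d : A -> nat) (j : A -> int).
Hypothesis dS : forall a, S a -> [/\ (0 < d a)%N, lam a = (d a)%:R^-1 &
                        rho a = (r + (j a)%:~R) / (d a)%:R].
Hypothesis stair : forall y, staircase S lam rho y = Num.floor (y + r).

Lemma class_height_floor (n : int) : n%:~R * Theta + r \isn't a Num.int ->
  class_height n = Num.floor (n%:~R * Theta + r).
Proof.
move=> xN; rewrite -stair /class_height; apply: eq_bigr => a Sa.
have e : n%:~R * theta a + rho a = lam a * (n%:~R * Theta) + rho a.
  by rewrite thetaS // mulrCA.
rewrite -e; apply: tracks_floor (ht a) _; apply: contra xN.
have [d0 la ra] := dS Sa; have d0' : (d a)%:R != 0 :> R by rewrite pnatr_eq0 -lt0n.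
rewrite e la ra => i1.
have -> : n%:~R * Theta + r = (d a)%:R * ((d a)%:R^-1 * (n%:~R * Theta)
     + (r + (j a)%:~R) / (d a)%:R) - (j a)%:~R by field.
by rewrite rpredB ?intr_int // rpredM // rpred_nat.
Qed.

(** Away from integers the class height is determined by [class_height_floor]. The
    line is an integer at one time at most, and there monotonicity from both sides
    leaves only the two allowed values. *)
Lemma class_tracks : tracks class_height Theta r.
Proof.
have /andP[Theta_gt0 Theta_lt1] := Theta01.
move=> n; have [xi|xN] := boolP (n%:~R * Theta + r \is a Num.int); last first.
  by rewrite class_height_floor //; have := floor_itv (n%:~R * Theta + r); rewrite intrD; lra.
have n1 : (n - 1)%:~R * Theta + r \isn't a Num.int.
  by apply/negP => /(irrational_int_once Theta_irr xi); lia.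
have n2 : (n + 1)%:~R * Theta + r \isn't a Num.int.
  by apply/negP => /(irrational_int_once Theta_irr xi); lia.
have s1 := class_heightS (n - 1); have s2 := class_heightS n; rewrite subrK in s1.
rewrite (class_height_floor n1) in s1; rewrite (class_height_floor n2) in s2.
move: xi => /intrP[z xz].
have e1 : (n - 1)%:~R * Theta + r = z%:~R - Theta by rewrite -xz; ring.
have e2 : (n + 1)%:~R * Theta + r = z%:~R + Theta by rewrite -xz; ring.
rewrite e1 in s1; rewrite e2 in s2; rewrite xz.
have floorb (x : R) : exists2 f : int, Num.floor x = f & f%:~R <= x < f%:~R + 1.
  by exists (Num.floor x) => //; have := floor_itv x; rewrite intrD.
have [f1 f1E b1] := floorb (z%:~R - Theta); have [f2 f2E b2] := floorb (z%:~R + Theta).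
rewrite f1E in s1; rewrite f2E in s2.
have l1 : z - 1 <= class_height n.
  have h1 : f1 <= class_height n by rewrite s1 lerDl.
  have : (z%:~R - 1 : R) < f1%:~R + 1 by lra.
  rewrite -[1](_ : 1%:~R = 1) // -intrB -intrD ltr_int ltzD1 => h2; exact: le_trans h2 h1.
have l2 : class_height n <= z.
  have h1 : class_height n <= f2 by rewrite s2 lerDl.
  have : (f2%:~R : R) < z%:~R + 1 by lra.
  rewrite -[1](_ : 1%:~R = 1) // -intrD ltr_int ltzD1 => h2; exact: le_trans h1 h2.
rewrite -(ler_int R) intrB in l1; rewrite -(ler_int R) in l2; lra.
Qed.

(** Reading [a] means that the line of [a] crosses an integer, which in the scale of
    the class line is the integer reached at time [n + 1]. *)
Lemma class_letter_residue (n : int) : S (W n) ->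
  ((d (W n))%:Z %| class_height (n + 1) + j (W n))%Z.
Proof.
have /andP[Theta_gt0 Theta_lt1] := Theta01.
move=> Sa; set a := W n in Sa *; have [d0 la ra] := dS Sa.
have d0R : 0 < (d a)%:R :> R by rewrite ltr0n.
have N1 : class_height (n + 1) = class_height n + 1 by rewrite class_heightS -/a Sa.
have h1 : h a (n + 1) = h a n + 1 by rewrite heightS eqxx.
have t0 := class_tracks n; have t1 := class_tracks (n + 1).
have a0 := ht a n; have a1 := ht a (n + 1).
have xE (m : int) : m%:~R * theta a + rho a = (m%:~R * Theta + r + (j a)%:~R) / (d a)%:R.
  by rewrite thetaS // la ra; field; rewrite gt_eqF.
move: a0 a1; rewrite !xE h1 => /andP[_ a0] /andP[a1 _].
rewrite ler_pdivrMr // in a0; rewrite ler_pdivlMr // in a1.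
suff -> : class_height (n + 1) + j a = (h a n + 1) * (d a)%:Z by rewrite dvdz_mull.
move: t0 t1; rewrite N1 !intrD => t0 t1.
have w1 : ((h a n + 1) * (d a)%:Z)%:~R < (class_height n + 1 + j a + 1)%:~R :> R.
  rewrite intrM -pmulrn !intrD; move: a1; rewrite !intrD; lra.
have w2 : (class_height n + 1 + j a)%:~R < ((h a n + 1) * (d a)%:Z + 1)%:~R :> R.
  rewrite !intrD intrM -pmulrn !intrD; lra.
move: w1 w2; rewrite !ltr_int !ltzD1 => w1 w2.
by apply/eqP; rewrite eq_le w1 w2.
Qed.

End ClassStructure.

(** The occurrences of the second class are numbered by the time elapsed minus the
    occurrences of the first one. *)
Theorem roulette_decomposition (R : realType) (A : finType) (W : int -> A) :
  balanced W -> nonperiodic W ->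
  exists (S S' : pred A) (alpha r : R) (d : A -> nat) (j : A -> int),
    [/\ 0 < alpha < 1 /\ irrational alpha,
        (forall a, S a -> ~~ S' a) /\ (forall n : int, S (W n) || S' (W n)),
        tracks (class_height W S) alpha r,
        constant_gaps S d j /\ constant_gaps S' d j &
        forall n : int,
          (S (W n) -> ((d (W n))%:Z %| class_height W S (n + 1) + j (W n))%Z) /\
          (S' (W n) -> ((d (W n))%:Z %| n + 1 - class_height W S (n + 1) + j (W n))%Z)].
Proof.
move=> hb np.
have /choice[tr htr] a : exists u : R * R, tracks (height W a) u.1 u.2.
  have [t [r h]] := balanced_tracks R (balanced_height_height a hb).
  by exists (t, r).
pose theta a := (tr a).1; pose rho a := (tr a).2.
have ht a : tracks (height W a) (theta a) (rho a) by exact: htr.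
have irr := irrational_letter_exists ht hb np.
have [p [q [pA pq]]] := sparse_shift_exists ht irr.
pose S := increasing_class theta p q; pose S' := decreasing_class theta p q.
have Sirr a : S a -> irrational (theta a) by case/andP => /asboolP.
have S'irr a : S' a -> irrational (theta a) by case/andP => /asboolP.
have disj a : S a -> ~~ S' a := @classes_disjoint _ _ theta p q a.
have covers a : irrational (theta a) -> S a || S' a.
  move=> ai; case: (boolP (S a)) => //= Sa; exact: (classes_cover pq ai Sa).
have split (V : zmodType) (f : A -> V) : (forall a, ~ irrational (theta a) -> f a = 0) ->
    \sum_(a | S a) f a + \sum_(a | S' a) f a = \sum_a f a.
  move=> f0; rewrite [RHS](bigID S) /=; congr (_ + _).
  rewrite [RHS](bigID S') /= [X in _ = _ + X]big1 ?addr0.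
    apply: eq_bigl => a; case: (boolP (S' a)); last by rewrite andbF.
    by rewrite andbT => S'a; apply/esym; apply/negP => /disj; rewrite S'a.
  move=> a /andP[Sa S'a]; apply: f0 => /covers; by rewrite (negPf Sa) (negPf S'a).
have [a0 a0i] := irr.
have absent c : ~ irrational (theta c) -> forall n, height W c n = 0.
  move=> cQ n; apply: absent_height => m; exact: (rational_absent ht hb pA pq irr cQ).
have hsum n : \sum_(a | S a) height W a n + \sum_(a | S' a) height W a n = n.
  by rewrite split ?sum_height // => a /absent.
pose Theta := \sum_(a | S a) theta a.
have ThetaE : 1 - Theta = \sum_(a | S' a) theta a.
  have := split _ theta (fun c cQ => rational_frequency_eq0 ht hb a0i cQ).
  by rewrite (sum_frequencies ht) => <-; rewrite addrC addKr.
have eps0 : \sum_(a | `[< irrational (theta a) >]) (p%:R * theta a - (q a)%:~R) = 0.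
  have [k _ t] := typical_near pA pq 0.
  have := typical_sum pA t; rewrite [X in _ + X]big1 ?addr0; last first.
    by move=> a /asboolPn aQ; rewrite !absent ?subrr.
  move=> qp; rewrite sumrB -mulr_sumr -(raddf_sum (intr : {additive int -> R})) qp.
  have := sum_frequencies ht; rewrite (bigID (fun a => `[< irrational (theta a) >])) /=.
  rewrite [X in _ + X]big1 ?addr0 => [->|a /asboolPn aQ]; first by rewrite mulr1 -pmulrn subrr.
  exact: (rational_frequency_eq0 ht hb a0i aQ).
have nz : exists2 a, `[< irrational (theta a) >] & p%:R * theta a - (q a)%:~R != 0.
  by exists a0; [apply/asboolP|have [] := pq a0 a0i].
have [a1 Sa1] : exists a, S a.
  have [a ai ea] := sum_eq0_exists_gt0 eps0 nz; exists a; by rewrite /S /increasing_class ai.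
have [b1 Sb1] : exists a, S' a.
  have [||a ai ea] := @sum_eq0_exists_gt0 _ R (fun a => `[< irrational (theta a) >])
     (fun a => - (p%:R * theta a - (q a)%:~R)).
  - by rewrite sumrN eps0 oppr0.
  - by have [a ai ea] := nz; exists a => //; rewrite oppr_eq0.
  by exists a; rewrite /S' /decreasing_class ai -oppr_gt0.
have q0 a : S a || S' a -> 0 < q a by case/orP => [/Sirr|/S'irr] /pq [].
pose Q := \sum_(a | S a) q a; pose Q' := \sum_(a | S' a) q a.
have Q0 : 0 < Q.
  rewrite /Q (bigD1 a1) //= ltr_pwDl ?q0 ?Sa1 //.
  by apply: sumr_ge0 => a /andP[Sa _]; rewrite ltW // q0 ?Sa.
have Q'0 : 0 < Q'.
  rewrite /Q' (bigD1 b1) //= ltr_pwDl ?q0 ?Sb1 ?orbT //.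
  by apply: sumr_ge0 => a /andP[Sa _]; rewrite ltW // q0 ?Sa ?orbT.
have Q0R : 0 < Q%:~R :> R by rewrite ltr0z.
have Q'0R : 0 < Q'%:~R :> R by rewrite ltr0z.
pose lam a : R := (q a)%:~R / (if S a then Q else Q')%:~R.
have S'S a : S' a -> S a = false by move=> S'a; apply/negP => /disj; rewrite S'a.
have lamS a : S a -> lam a * Q%:~R = (q a)%:~R.
  by move=> Sa; rewrite /lam Sa divfK // gt_eqF.
have lamS' a : S' a -> lam a * Q'%:~R = (q a)%:~R.
  by move=> Sa; rewrite /lam S'S // divfK // gt_eqF.
have lam0 a : S a || S' a -> 0 < lam a.
  by move=> Sa; rewrite /lam divr_gt0 // ?ltr0z ?q0 //; case: ifP.
have thetaS a : S a -> theta a = lam a * Theta.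
  move=> Sa; rewrite /lam Sa /Theta mulrAC mulr_sumr.
  rewrite (eq_bigr (fun b => (q b)%:~R * theta a)); last first.
    by move=> b Sb; apply: (class_proportional ht pA Sirr (increasing_return ht hb pA pq irr)).
  rewrite -mulr_suml -(raddf_sum (intr : {additive int -> R})) -/Q.
  by rewrite mulrC mulKf // gt_eqF.
have thetaS' a : S' a -> theta a = lam a * (1 - Theta).
  move=> Sa; rewrite /lam S'S // ThetaE mulrAC mulr_sumr.
  rewrite (eq_bigr (fun b => (q b)%:~R * theta a)); last first.
    by move=> b Sb; apply: (class_proportional ht pA S'irr (decreasing_return ht hb pA pq irr)).
  rewrite -mulr_suml -(raddf_sum (intr : {additive int -> R})) -/Q'.
  by rewrite mulrC mulKf // gt_eqF.
have theta0 a : irrational (theta a) -> 0 < theta a.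
  move=> ai; rewrite lt0r (frequency_ge0 ht) andbT; apply/eqP => e.
  by have := ai 1%N isT; rewrite e mulr0 rpred0.
have Theta_gt0 : 0 < Theta.
  by have := theta0 _ (Sirr _ Sa1); rewrite thetaS // pmulr_rgt0 // lam0 ?Sa1.
have Theta_lt1 : 0 < 1 - Theta.
  by have := theta0 _ (S'irr _ Sb1); rewrite thetaS' // pmulr_rgt0 // lam0 ?Sb1 ?orbT.
have Ti : irrational Theta.
  have -> : Theta = `|Q|%N%:R / `|q a1|%N%:R * theta a1.
    rewrite thetaS // /lam Sa1 !pmulrn !gez0_abs ?ltW ?q0 ?Sa1 //.
    by field; rewrite !gt_eqF // ltr0z q0 ?Sa1.
  by apply: irrational_scale (Sirr _ Sa1); rewrite absz_gt0 gt_eqF // q0 ?Sa1.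
have Ti' := irrational_compl Ti.
have Theta01 : 0 < Theta < 1 by rewrite Theta_gt0 -subr_gt0.
have Theta01' : 0 < 1 - Theta < 1 by rewrite Theta_lt1; lra.
have disj' a : S' a -> ~~ S a by move/S'S ->.
have hsum' n : \sum_(a | S' a) height W a n + \sum_(a | S a) height W a n = n.
  by rewrite addrC hsum.
have lam0' a : S' a || S a -> 0 < lam a by rewrite orbC; exact: lam0.
have thetaS1 a : S a -> theta a = lam a * (1 - (1 - Theta)) by rewrite subKr; exact: thetaS.
have sh y : staircase S lam rho (y + 1) = staircase S lam rho y + 1.
  exact: (staircase_shift ht disj hsum Ti Q0 Q'0 erefl erefl lamS lamS' lam0 thetaS thetaS').
have sh' y : staircase S' lam rho (y + 1) = staircase S' lam rho y + 1.
  exact: (staircase_shift ht disj' hsum' Ti' Q'0 Q0 erefl erefl lamS' lamS lam0' thetaS' thetaS1).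
have lamp a : S a -> 0 < lam a by move=> Sa; rewrite lam0 ?Sa.
have lamp' a : S' a -> 0 < lam a by move=> Sa; rewrite lam0 ?Sa ?orbT.
have [r [d [j [dS st]]]] := staircase_lattice lamp (ex_intro S a1 Sa1) sh.
have [r' [d' [j' [dS' st']]]] := staircase_lattice lamp' (ex_intro S' b1 Sb1) sh'.
pose D a := if S a then d a else d' a; pose J a := if S a then j a else j' a.
exists S, S', Theta, r, D, J; split.
- by [].
- by split=> // n; apply: covers; exact: (letters_irrational ht hb pA pq irr).
- exact: class_tracks dS st.
- split; split.
  + by move=> a Sa; rewrite /D Sa; have [] := dS a Sa.
  + move=> i; have [a Sa da] := residue_class_exists dS st i.
    by exists a => //; rewrite /D /J Sa.
  + move=> i a b Sa Sb; rewrite /D /J Sa Sb; exact: (residue_class_unique dS st).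
  + by move=> a Sa; rewrite /D S'S //; have [] := dS' a Sa.
  + move=> i; have [a Sa da] := residue_class_exists dS' st' i.
    by exists a => //; rewrite /D /J S'S.
  + move=> i a b Sa Sb; rewrite /D /J !S'S //; exact: (residue_class_unique dS' st').
- move=> n; split=> Sn.
    rewrite /D /J Sn; exact: (class_letter_residue ht Ti Theta01 thetaS dS st Sn).
  rewrite /D /J S'S //.
  have -> : n + 1 - class_height W S (n + 1) = class_height W S' (n + 1).
    by rewrite -[X in X - _](hsum (n + 1)) addrAC subrr add0r.
  exact: (class_letter_residue ht Ti' Theta01' thetaS' dS' st' Sn).
Qed.

(** * The phase space *)

Lemma onth_subword (A : Type) (W : int -> A) (i : int) (n t : nat) (a : A) :
  onth (subword W i n) t = Some a <-> (t < n)%N /\ W (i + t%:Z) = a.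
Proof.
rewrite onthE /subword /mkseq -map_comp; split.
  have [tn|nt] := ltnP t n; last by rewrite nth_default ?size_map ?size_iota.
  by rewrite (nth_map 0%N) ?size_iota // nth_iota // => -[].
by move=> [tn <-]; rewrite (nth_map 0%N) ?size_iota // nth_iota.
Qed.

Section PhaseTopology.
Local Open Scope quotient_scope.
Local Open Scope classical_set_scope.
Variables (R : realType) (m : nat).
Local Notation pt := (@circle_pt R m).
Implicit Types (x y alpha : R) (c : 'I_m).

Lemma circle_pt_surj (p : circle R m) : exists x, p = pt x.
Proof. by exists (repr (p : {eq_quot (@circle_equiv R m)})); rewrite /circle_pt reprK. Qed.

(** The projection of the line onto the circle is open, and components are open. *)
Lemma nbhs_phaseP x c (V : set (phase_space R m)) :
  nbhs ((pt x, c) : phase_space R m) V <->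
  exists2 eps : R, 0 < eps & forall y, `|y - x| < eps -> V (pt y, c).
Proof.
split.
  move=> [[P Q] /= [nP nQ] PQV].
  have : nbhs x (pt @^-1` P) by apply: (pi_continuous nP).
  move=> /nbhs_ballP [eps /= eps0 h]; exists eps => // y yx.
  apply: PQV; split=> /=; last exact: nbhs_singleton nQ.
  by apply: h; rewrite /ball /= distrC.
move=> [eps eps0 h].
pose P := [set p | exists2 y, `|y - x| < eps & p = pt y].
exists (P, [set c]); last by move=> [_ _] /= [[y yx ->] ->]; exact: h.
split=> /=; last exact: discrete_set1.
apply: open_nbhs_nbhs; split; last by exists x => //; rewrite subrr normr0.
suff oP : open (pt @^-1` P) by [].
rewrite openE => z [y yx /circle_ptP zy]; apply/nbhs_ballP.
exists (eps - `|y - x|) => [|z']; first by rewrite /= subr_gt0.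
rewrite /ball /= => zz'; exists (y + (z' - z)).
  rewrite addrAC; apply: le_lt_trans (ler_normD _ _) _.
  by rewrite -ltrBrDl distrC.
by apply/circle_ptP; rewrite (_ : z' - _ = z - y) //; ring.
Qed.

Lemma open_interval_image (lo hi : R) c :
  open ([set p | exists2 y, lo < y < hi & p = (pt y, c)] : set (phase_space R m)).
Proof.
rewrite openE => _ [y /andP[ly yh] ->]; apply/nbhs_phaseP.
exists (Num.min (y - lo) (hi - y)); first by rewrite lt_min !subr_gt0 ly.
move=> z; rewrite lt_min !ltr_norml => hz; exists z => //; lra.
Qed.

Lemma iterz_step alpha x c (n : int) :
  iterz (step alpha) (step_inv alpha) n ((pt x, c) : phase_space R m)
  = (pt (x + n%:~R * alpha), iterz (@ordS m) (@ord_pred m) n c).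
Proof.
case: n => n /=.
  elim: n => [|n IH]; first by rewrite mul0r addr0.
  rewrite iterS IH /step /= circle_rot_pt; congr (_, _); congr pt.
  by rewrite -!pmulrn -[in RHS]natr1; ring.
have pred y c' : step_inv alpha ((pt y, c') : phase_space R m) = (pt (y - alpha), ord_pred c').
  by rewrite /step_inv /= circle_rot_pt.
elim: n => [|n IH]; first by rewrite pred (_ : (Negz 0)%:~R = -1) ?mulN1r.
rewrite [LHS](congr1 (step_inv alpha) IH) pred; congr (_, _); congr pt; rewrite !NegzE !mulrNz -!pmulrn.
by rewrite -[in RHS]natr1; ring.
Qed.

Lemma iterz_component c (n : int) :
  (m%:Z %| (iterz (@ordS m) (@ord_pred m) n c)%:Z - c%:Z - n)%Z.
Proof.
have m0 : (0 < m)%N by case: m c => [[]|].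
have up (c' : 'I_m) : (m%:Z %| (ordS c')%:Z - c'%:Z - 1)%Z.
  rewrite /=; have := divn_eq c'.+1 m; set w := (_ %/ _)%N => e.
  by apply/dvdzP; exists (- w%:Z); lia.
have dn (c' : 'I_m) : (m%:Z %| (ord_pred c')%:Z - c'%:Z + 1)%Z.
  rewrite /=; have := divn_eq (c' + m).-1 m; set w := (_ %/ _)%N => e.
  by apply/dvdzP; exists (1 - w%:Z); lia.
have trans (a b e : int) : (m%:Z %| a)%Z -> (m%:Z %| b)%Z -> e = a + b -> (m%:Z %| e)%Z.
  by move=> am bm ->; rewrite rpredD.
case: n => n.
  elim: n => [|n IH]; first by rewrite subrr subr0 dvdz0.
  apply: trans (up (iterz (@ordS m) (@ord_pred m) n c)) IH _.
  by rewrite -[iterz _ _ n.+1 c]/(ordS (iterz (@ordS m) (@ord_pred m) n c)); lia.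
elim: n => [|n IH].
  by apply: trans (dn c) (dvdz0 _) _; rewrite -[iterz _ _ (Negz 0) c]/(ord_pred c); lia.
apply: trans (dn (iterz (@ordS m) (@ord_pred m) (Negz n) c)) IH _.
rewrite -[iterz _ _ (Negz n.+1) c]/(ord_pred (iterz (@ordS m) (@ord_pred m) (Negz n) c)); lia.
Qed.

(** At a point off the boundaries an essential evolution is an evolution: points of
    [U (W n)] accumulate at the n-th iterate, which therefore lies in the closure
    of [U (W n)], hence in its interior. *)
Lemma essential_generates (A : finType) (U : A -> set (phase_space R m)) alpha
    (W : int -> A) x c :
  (forall a b p, U a p -> U b p -> a = b) ->
  essential_evolution (M := phase_space R m) (step alpha) (step_inv alpha) U W (pt x, c) ->
  generates (M := phase_space R m) (step alpha) (step_inv alpha) U W.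
Proof.
move=> disj ess; exists (pt x, c).
have [hits|nhits] := pselect (hits_boundary (M := phase_space R m)
    (step alpha) (step_inv alpha) U (pt x, c)); [by right|left; split=> //].
suff UW (n : int) : U (W n) (iterz (step alpha) (step_inv alpha) n (pt x, c)).
  by move=> n a; split=> [<-|Ua]; [exact: UW|exact: disj (UW n) Ua].
apply: interior_subset; apply: contrapT => nint; apply: nhits; exists n, (W n).
split=> // V; rewrite iterz_step => /nbhs_phaseP [eps eps0 epsV].
have nx : nbhs ((pt x, c) : phase_space R m)
    [set p | exists2 y, `|y - x| < eps & p = (pt y, c)].
  by apply/nbhs_phaseP; exists eps => // y yx; exists y.
have [O [_ [p Op] OV /(_ p Op) fin]] := ess `|n|%N _ nx.
have [y yx py] := OV p Op.
exists (iterz (step alpha) (step_inv alpha) n p); split.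
  have := fin (absz (n + `|n|%N%:Z)) (W n).
  rewrite (_ : - `|n|%N%:Z + (absz (n + `|n|%N%:Z))%:Z = n); last lia.
  by apply; apply/onth_subword; split; [lia|congr W; lia].
rewrite py iterz_step; apply: epsV.
by rewrite opprD addrACA subrr addr0.
Qed.

End PhaseTopology.

(** * The two roulettes *)

Section Roulettes.
Local Open Scope classical_set_scope.
Variables (R : realType) (m : nat) (m0 : (0 < m)%N) (alpha : R) (k l : nat).
Hypothesis alpha01 : 0 < alpha < 1.
Variables (red : int -> 'I_k) (blue : int -> 'I_l).
Local Notation pt := (@circle_pt R m).

Definition periodic_hue n (f : int -> 'I_n) :=
  forall i i' : int, (m%:Z %| i - i')%Z -> f i = f i'.

Hypothesis red_per : periodic_hue red.
Hypothesis blue_per : periodic_hue blue.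

(** The place of a blue arc in the blue word decreases with [i], because a point
    reads the fewer blue letters the more integers it passes. *)
Definition roulettes : coloring R m k l :=
  Coloring (fun _ i => pt i%:R) (fun _ i => pt (i%:R + alpha))
    (fun _ i => red i%:Z) (fun c i => blue (c%:Z + 1 - i%:Z)).

Lemma circle_length_gt0 : 0 < m%:R :> R. Proof. by rewrite ltr0n. Qed.

Lemma circle_ptE (x y : R) : pt x = pt y <-> exists z : int, x - y = z%:~R * m%:R.
Proof.
have m0' : m%:R != 0 :> R by rewrite gt_eqF // circle_length_gt0.
split=> [/circle_ptP /intrP [z e]|[z e]]; first by exists z; rewrite -e divfK.
by apply/circle_ptP; rewrite e mulfK // intr_int.
Qed.

Lemma circle_pt_dvd (x : R) (i i' : int) : (m%:Z %| i - i')%Z ->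
  pt (i%:~R + x) = pt (i'%:~R + x).
Proof.
move=> /dvdzP [z e]; apply/circle_ptE; exists z.
by rewrite opprD addrACA subrr addr0 -intrB e intrM -pmulrn.
Qed.

Lemma circle_arcP (s len x : R) : circle_arc (pt s) len (pt x) <->
  exists z : int, 0 <= x - s - z%:~R * m%:R < len.
Proof.
split=> [[t /= t01]|[z z01]].
  rewrite circle_rot_pt => /circle_ptE [z e]; exists (- z).
  by rewrite mulrNz; move: t01; rewrite (_ : t = x - s + z%:~R * m%:R); [lra|rewrite -e; ring].
exists (x - s - z%:~R * m%:R) => //=; rewrite circle_rot_pt; apply/circle_ptE.
by exists (- z); rewrite mulrNz; ring.
Qed.

Lemma ord_residue (i : int) : exists i' : 'I_m, (m%:Z %| i - i'%:Z)%Z.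
Proof.
have m0' : m%:Z != 0 by rewrite -lt0n.
have h0 := modz_ge0 i m0'; have h1 := ltz_mod i m0'.
have hm : (`|(i %% m)%Z|%N < m)%N by move: h0 h1; case: (i %% m)%Z => //= n _; rewrite ltz_nat.
exists (Ordinal hm) => /=; rewrite gez0_abs //.
by apply/dvdzP; exists (i %/ m)%Z; rewrite {1}(divz_eq i m) addrK.
Qed.

Lemma ord_residue_unique (i : int) (i1 i2 : 'I_m) :
  (m%:Z %| i - i1%:Z)%Z -> (m%:Z %| i - i2%:Z)%Z -> i1 = i2.
Proof.
move=> d1 d2; apply: val_inj => /=; have := rpredB d1 d2.
rewrite (_ : _ - _ = i2%:Z - i1%:Z); last lia.
move=> /dvdzP [z e]; have := ltn_ord i1; have := ltn_ord i2.
case: (ltrgtP z 0) e => [z0|z0|->] e; last lia.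
- have : z * m%:Z <= - m%:Z by rewrite -mulN1r ler_pM2r //; lia.
  lia.
- have : m%:Z <= z * m%:Z by rewrite -[leLHS]mul1r ler_pM2r //; lia.
  lia.
Qed.

Lemma red_arcP (c i : 'I_m) (x : R) : red_arc alpha roulettes c i (pt x) <->
  x - (Num.floor x)%:~R < alpha /\ (m%:Z %| Num.floor x - i%:Z)%Z.
Proof.
have /andP[a0 a1] := alpha01.
rewrite /red_arc /= circle_arcP; split=> [[z hz]|[xa /dvdzP [z fz]]].
  have fx : Num.floor x = i%:Z + z * m%:Z.
    by apply: floor_def; rewrite !intrD intrM -!pmulrn; lra.
  rewrite fx intrD intrM -!pmulrn; split; first lra.
  by apply/dvdzP; exists z; rewrite addrAC subrr add0r.
exists z; have -> : x - i%:R - z%:~R * m%:R = x - (Num.floor x)%:~R.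
  by rewrite (_ : Num.floor x = z * m%:Z + i%:Z); [ring|rewrite -fz subrK].
by rewrite subr_ge0 floor_le.
Qed.

Lemma blue_arcP (c i : 'I_m) (x : R) : blue_arc alpha roulettes c i (pt x) <->
  alpha <= x - (Num.floor x)%:~R /\ (m%:Z %| Num.floor x - i%:Z)%Z.
Proof.
have /andP[a0 a1] := alpha01.
rewrite /blue_arc /= circle_arcP; split=> [[z hz]|[xa /dvdzP [z fz]]].
  have fx : Num.floor x = i%:Z + z * m%:Z.
    by apply: floor_def; rewrite !intrD intrM -!pmulrn; lra.
  rewrite fx intrD intrM -!pmulrn; split; first lra.
  by apply/dvdzP; exists z; rewrite addrAC subrr add0r.
exists z; have -> : x - (i%:R + alpha) - z%:~R * m%:R = x - (Num.floor x)%:~R - alpha.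
  by rewrite (_ : Num.floor x = z * m%:Z + i%:Z); [ring|rewrite -fz subrK].
have := floorD1_gt x; rewrite intrD; lra.
Qed.

Lemma ordS_residue (i : 'I_m) : (m%:Z %| i%:Z + 1 - (ordS i)%:Z)%Z.
Proof.
rewrite /=; have := divn_eq i.+1 m; set w := (_ %/ _)%N => e.
by apply/dvdzP; exists w%:Z; lia.
Qed.

Lemma roulettes_alternate : alternating_division alpha roulettes.
Proof.
split=> // [c p|c i|c i].
- have [x ->] := circle_pt_surj p; have [i hi] := ord_residue (Num.floor x).
  have [xa|ax] := ltP (x - (Num.floor x)%:~R) alpha.
    exists (inl i); split; first exact/red_arcP.
    move=> [j /red_arcP [_ hj]|j /blue_arcP [h _]].
      by congr inl; exact: ord_residue_unique hi hj.
    by move: (lt_le_trans xa h); rewrite ltxx.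
  exists (inr i); split; first exact/blue_arcP.
  move=> [j /red_arcP [h _]|j /blue_arcP [_ hj]].
    by move: (lt_le_trans h ax); rewrite ltxx.
  by congr inr; exact: ord_residue_unique hi hj.
- by rewrite /= circle_rot_pt.
- rewrite /= circle_rot_pt addrA addrAC addrK natr1.
  have := circle_pt_dvd 0 (ordS_residue i); rewrite !addr0 intrD -!pmulrn => <-.
  by rewrite natr1.
Qed.

Lemma roulettes_rotate : rotating_roulettes roulettes.
Proof.
split=> c i; split=> //=.
  rewrite circle_rot_pt.
  have := circle_pt_dvd alpha (ordS_residue i); rewrite intrD -!pmulrn => <-.
  by congr pt; ring.
apply: blue_per.
rewrite (_ : _ - _ = i%:Z + 1 - (ordS i)%:Z - (c%:Z + 1 - (ordS c)%:Z)); last by ring.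
by rewrite rpredB // ordS_residue.
Qed.

(** Places [d] apart on a circle of length [m], with [m / d] of them. *)
Lemma progression_polygon (P : 'I_m -> Prop) (d : nat) (i0 : int) (x : R) :
  (0 < d)%N -> (d %| m)%N -> (forall i : 'I_m, P i <-> (d%:Z %| i%:Z - i0)%Z) ->
  regular_polygon [set pt (i%:R + x) | i in [set i | P i]].
Proof.
move=> d0 /dvdnP [n mE] HP.
have n0 : (0 < n)%N by case: (n) mE m0 => // ->.
have dE : m%:R / n%:R = d%:R :> R.
  by rewrite mE natrM mulrAC mulfV ?mul1r // pnatr_eq0 -lt0n.
have dm (a : int) : (m%:Z %| a)%Z -> (d%:Z %| a)%Z.
  by apply: dvdz_trans; apply/dvdzP; exists n%:Z; rewrite mE PoszM.
exists n, (pt (i0%:~R + x)); split=> //; apply/seteqP; split.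
  move=> _ [i /HP /dvdzP [w iw] <-].
  have n0' : n%:Z != 0 by rewrite -lt0n.
  have h0 := modz_ge0 w n0'; have h1 := ltz_mod w n0'.
  exists (absz (w %% n)%Z).
    by move: h0 h1; case: (w %% n)%Z => //= t _; rewrite ltz_nat.
  rewrite dE circle_rot_pt addrAC pmulrn gez0_abs //.
  have -> : i%:R = i%:Z%:~R :> R by [].
  have -> : (w %% n)%Z%:~R * d%:R = ((w %% n)%Z * d%:Z)%:~R :> R by rewrite intrM.
  rewrite -intrD; apply: circle_pt_dvd; apply/dvdzP; exists (- (w %/ n)%Z).
  have := divz_eq w n; set e := (w %/ n)%Z; set f := (w %% n)%Z => we.
  have -> : i0 + f * d%:Z - i%:Z = f * d%:Z - w * d%:Z by rewrite -iw; ring.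
  by rewrite we mE PoszM; ring.
move=> _ [t /= tn <-]; rewrite dE circle_rot_pt.
have [i hi] := ord_residue (i0 + t%:Z * d%:Z).
exists i.
  apply/HP; rewrite (_ : i%:Z - i0 = t%:Z * d%:Z - (i0 + t%:Z * d%:Z - i%:Z)); last lia.
  by rewrite rpredB ?(dm _ hi) // dvdz_mull.
have := circle_pt_dvd x hi; rewrite intrD intrM -!pmulrn => <-.
by congr pt; ring.
Qed.

Definition constant_gap_hues n (f : int -> 'I_n) := forall i0 : int,
  exists d : nat, [/\ (0 < d)%N, (d %| m)%N &
    forall i : int, f i = f i0 <-> (d%:Z %| i - i0)%Z].

Lemma roulettes_polygonal : constant_gap_hues red -> constant_gap_hues blue ->
  polygonal_hues alpha roulettes.
Proof.
move=> redg blueg; split=> c h [_ [i0 /= hi0 _]].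
  have [d [d0 dm hd]] := redg i0%:Z.
  rewrite /red_midpoints (_ : (fun i => _) = (fun i : 'I_m => pt (i%:R + alpha / 2))).
    by apply: (progression_polygon (alpha / 2) d0 dm) => i; rewrite /= -hi0; exact: hd.
  by apply/funext => i; rewrite /midpoint /= circle_rot_pt.
have [d [d0 dm hd]] := blueg (c%:Z + 1 - i0%:Z).
rewrite /blue_midpoints (_ : (fun i => _) = (fun i : 'I_m => pt (i%:R + (alpha + (1 - alpha) / 2)))).
  apply: (progression_polygon (i0 := i0%:Z) _ d0 dm) => i; rewrite /= -hi0 hd.
  have -> : c%:Z + 1 - i%:Z - (c%:Z + 1 - i0%:Z) = - (i%:Z - i0%:Z) by ring.
  by rewrite rpredN.
by apply/funext => i; rewrite /midpoint /= circle_rot_pt addrA.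
Qed.

(** The letter at a point of the line depends on its fractional part, which gives
    the colour, and on its integral part, which gives the place in the word of
    this colour. *)
Lemma char_set_roulettes (A : Type) (letter : 'I_k + 'I_l -> A) (a : A) (x : R) (c : 'I_m) :
  char_set alpha roulettes letter a (pt x, c) <->
  letter (if x - (Num.floor x)%:~R < alpha then inl (red (Num.floor x))
          else inr (blue (c%:Z + 1 - Num.floor x))) = a.
Proof.
split.
  move=> [i [[<- /red_arcP [-> hi]]|[<- /blue_arcP [ha hi]]]] /=.
    by rewrite (red_per hi).
  rewrite ltNge ha /=; congr letter; congr inr; apply: blue_per.
  have -> : c%:Z + 1 - Num.floor x - (c%:Z + 1 - i%:Z) = - (Num.floor x - i%:Z) by ring.
  by rewrite rpredN.
have [i hi] := ord_residue (Num.floor x).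
case: ltP => ha <-; exists i; [left|right]; split.
- by rewrite /= (red_per hi).
- exact/red_arcP.
- rewrite /=; congr letter; congr inr; apply: blue_per.
  have -> : c%:Z + 1 - i%:Z - (c%:Z + 1 - Num.floor x) = Num.floor x - i%:Z by ring.
  by [].
- exact/blue_arcP.
Qed.

End Roulettes.

(** The line meets an integer at one time at most, so that the heights are either
    all strictly below the line, or all strictly above the line lowered by 1. There
    is then room to move the line slightly down, respectively up, during a finite
    time. *)
Lemma tracks_window (R : realType) (h : int -> int) (theta rho : R) (n : nat) (eps : R) :
  irrational theta -> tracks h theta rho -> 0 < eps ->
  exists lo hi : R, [/\ lo < hi, rho - eps <= lo, hi <= rho + eps &
    forall y, lo < y < hi -> forall t : int, `|t| <= n%:Z ->
      Num.floor (y + t%:~R * theta) = h t].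
Proof.
move=> ti ht eps0; pose tm (u : 'I_n.*2.+1) : int := u%:Z - n%:Z.
have tmP (t : int) : `|t| <= n%:Z -> exists u, t = tm u.
  move=> tn; have hu : (absz (t + n%:Z)%R < n.*2.+1)%N by lia.
  by exists (Ordinal hu); rewrite /tm /=; lia.
have [[t1 ht1]|no] := pselect (exists t1 : int, (h t1)%:~R + 1 = t1%:~R * theta + rho).
  have up (t : int) : (h t)%:~R < t%:~R * theta + rho.
    have /andP[h1 _] := ht t; rewrite lt_neqAle h1 andbT; apply/eqP => e.
    have tt1 : t = t1.
      apply: (irrational_int_once ti (rho := rho)); first by rewrite -e intr_int.
      by rewrite -ht1 rpredD ?intr_int ?rpred1.
    by move: ht1; rewrite -tt1 -e => /eqP; rewrite -subr_eq0 addrAC subrr add0r oner_eq0.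
  have f0 u : 0 < (tm u)%:~R * theta + rho - (h (tm u))%:~R by rewrite subr_gt0 up.
  have [eta eta0 etaf] := common_lower_bound f0.
  exists (rho - Num.min eps eta), rho.
  have [m1 m2 m3] : [/\ 0 < Num.min eps eta, Num.min eps eta <= eps & Num.min eps eta <= eta].
    by rewrite lt_min eps0 eta0 !ge_min !lexx orbT.
  split; [lra|lra|lra|] => y hy t /tmP [u ->].
  apply: floor_def; rewrite intrD; have := etaf u; have := ht (tm u); lra.
have up (t : int) : t%:~R * theta + rho < (h t)%:~R + 1.
  have /andP[_ h1] := ht t; rewrite lt_neqAle h1 andbT; apply/eqP => e.
  by apply: no; exists t.
have f0 u : 0 < (h (tm u))%:~R + 1 - ((tm u)%:~R * theta + rho) by rewrite subr_gt0 up.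
have [eta eta0 etaf] := common_lower_bound f0.
exists rho, (rho + Num.min eps eta).
have [m1 m2 m3] : [/\ 0 < Num.min eps eta, Num.min eps eta <= eps & Num.min eps eta <= eta].
  by rewrite lt_min eps0 eta0 !ge_min !lexx orbT.
split; [lra|lra|lra|] => y hy t /tmP [u ->].
apply: floor_def; rewrite intrD; have := etaf u; have := ht (tm u); lra.
Qed.

(** * Balanced words as evolutions *)

Section GapSelection.
Variables (A : finType) (S : pred A) (d : A -> nat) (j : A -> int) (m : nat).
Hypothesis gaps : constant_gaps S d j.
Hypothesis dm : forall a, S a -> (d a %| m)%N.

(** The word whose place [i] carries the letter owning the residue class of [i]. *)
Lemma gap_selection : exists f : int -> A,
  [/\ forall i, S (f i),
      forall i a, S a -> ((d a)%:Z %| i + j a)%Z -> f i = a,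
      forall i i' : int, (m%:Z %| i - i')%Z -> f i = f i' &
      forall i0 : int, exists e : nat, [/\ (0 < e)%N, (e %| m)%N &
        forall i : int, f i = f i0 <-> (e%:Z %| i - i0)%Z]].
Proof.
have [d0 ex uniq] := gaps.
have /choice[f hf] (i : int) : exists a, S a /\ ((d a)%:Z %| i + j a)%Z.
  by have [a Sa da] := ex i; exists a.
have fE (i : int) a : S a -> ((d a)%:Z %| i + j a)%Z -> f i = a.
  by move=> Sa da; have [Sf df] := hf i; exact: uniq df da.
have gap (i i0 : int) : f i = f i0 <-> ((d (f i0))%:Z %| i - i0)%Z.
  have [Sf df] := hf i0; split=> [e|di].
    have [_] := hf i; rewrite e => df'.
    have -> : i - i0 = i + j (f i0) - (i0 + j (f i0)) by ring.
    exact: rpredB.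
  apply: fE => //.
  have -> : i + j (f i0) = i - i0 + (i0 + j (f i0)) by ring.
  exact: rpredD.
exists f; split=> //.
- by move=> i; have [] := hf i.
- move=> i i' ii'; apply/gap; apply: dvdz_trans ii'.
  by apply: dm; have [] := hf i'.
- move=> i0; have [Sf _] := hf i0; exists (d (f i0)).
  by split; [exact: d0|exact: dm|move=> i; exact: gap].
Qed.

End GapSelection.

Lemma letters_split (A : finType) (D : {set A}) (a0 b0 : A)
    (Da : a0 \in D) (Db : b0 \in ~: D) :
  exists letter : 'I_#|D| + 'I_#|~: D| -> A,
    [/\ bijective letter,
        forall a, a \in D -> letter (inl (enum_rank_in Da a)) = a &
        forall a, a \in ~: D -> letter (inr (enum_rank_in Db a)) = a].
Proof.
pose letter (h : 'I_#|D| + 'I_#|~: D|) :=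
  match h with inl i => enum_val i | inr i => enum_val i end.
exists letter; split; [|by move=> a aD /=; rewrite enum_rankK_in..].
exists (fun a => if a \in D then inl (enum_rank_in Da a) else inr (enum_rank_in Db a)).
  case=> i /=; first by rewrite (enum_valP i) enum_valK_in.
  by have := enum_valP i; rewrite inE => /negPf ->; rewrite enum_valK_in.
by move=> a; case: ifP => aD /=; rewrite enum_rankK_in // inE aD.
Qed.

Theorem mainTheorem3 (R : realType) (A : finType) (W : int -> A)
    (hbal : balanced W) (hnp : nonperiodic W) :
  exists (m : nat) (alpha : R) (k l : nat) (C : coloring R m k l)
         (letter : 'I_k + 'I_l -> A),
    [/\ (0 < m)%N,
        bijective letter /\ (k + l)%N = #|A|,
        alternating_division alpha C,
        polygonal_hues alpha C /\ rotating_roulettes C &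
        generates (M := phase_space R m) (step alpha) (step_inv alpha)
          (char_set alpha C letter) W].
Proof.
have [S [S' [alpha [rho [d [j [[alpha01 ai] [disj cover] tr [gS gS'] res]]]]]]] :=
  roulette_decomposition R hbal hnp.
pose m := (\prod_(a | S a || S' a) d a)%N.
have dm a : S a || S' a -> (d a %| m)%N by move=> Sa; rewrite /m (bigD1 a) //= dvdn_mulr.
have m0 : (0 < m)%N.
  rewrite /m prodn_cond_gt0 // => a /orP[Sa|Sa].
    by have [+ _ _] := gS; apply.
  by have [+ _ _] := gS'; apply.
have [r [rS rE rper rgap]] := gap_selection gS (fun a Sa => dm a (introT orP (or_introl Sa))).
have [s [sS sE sper sgap]] := gap_selection gS' (fun a Sa => dm a (introT orP (or_intror Sa))).
pose D : {set A} := [set a | S a].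
have rD i : r i \in D by rewrite inE.
have sD i : s i \in ~: D by rewrite !inE; apply/negP => /disj; rewrite sS.
have [letter [letter_bij letter_red letter_blue]] := letters_split (rD 0) (sD 0).
pose red i := enum_rank_in (rD 0) (r i); pose blue i := enum_rank_in (sD 0) (s i).
have red_per : periodic_hue m red by move=> i i' /rper; rewrite /red => ->.
have blue_per : periodic_hue m blue by move=> i i' /sper; rewrite /blue => ->.
have redE i i' : red i = red i' <-> r i = r i'.
  split=> [/(congr1 (letter \o inl)) /=|]; last by rewrite /red => ->.
  by rewrite /red !letter_red.
have blueE i i' : blue i = blue i' <-> s i = s i'.
  split=> [/(congr1 (letter \o inr)) /=|]; last by rewrite /blue => ->.
  by rewrite /blue !letter_blue.
have red_gap : constant_gap_hues m red.
  by move=> i0; have [e [e0 em h]] := rgap i0; exists e; split=> // i; rewrite redE.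
have blue_gap : constant_gap_hues m blue.
  by move=> i0; have [e [e0 em h]] := sgap i0; exists e; split=> // i; rewrite blueE.
exists m, alpha, #|D|, #|~: D|, (roulettes m alpha red blue), letter; split=> //.
- by split=> //; rewrite cardsC.
- exact: roulettes_alternate.
- split; [exact: roulettes_polygonal|exact: roulettes_rotate].
pose c0 : 'I_m := Ordinal m0.
(* The start is at [rho + alpha] because the letter at time [n] is the one at the
   last integer passed, while [class_height] at [n] counts the letters before. *)
apply: (@essential_generates _ _ _ _ _ _ (rho + alpha) c0).
  move=> a b [p c]; have [x ->] := circle_pt_surj p.
  by rewrite !char_set_roulettes // => <- <-.
move=> n V /nbhs_phaseP [eps eps0 epsV].
have [lo [hi [lohi elo ehi window]]] := tracks_window n.+1 ai tr eps0.
exists [set p | exists2 y, lo + alpha < y < hi + alpha & p = (circle_pt m y, c0)]%classic; split.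
- exact: open_interval_image.
- exists (circle_pt m ((lo + hi) / 2 + alpha), c0), ((lo + hi) / 2 + alpha) => //; lra.
- move=> _ [y hy ->]; apply: epsV; rewrite ltr_norml; lra.
move=> _ [y hy ->] t a /onth_subword [tn <-].
set u : int := - n%:Z + t%:Z; rewrite iterz_step.
apply/char_set_roulettes => //.
have un : `|u| <= n.+1%:Z /\ `|u + 1| <= n.+1%:Z by rewrite /u; lia.
have hy' : lo < y - alpha < hi by lra.
have w0 := window _ hy' u (proj1 un); have w1 := window _ hy' (u + 1) (proj2 un).
have e1 : y - alpha + (u + 1)%:~R * alpha = y + u%:~R * alpha by rewrite intrD; ring.
have e0 : y - alpha + u%:~R * alpha = y + u%:~R * alpha - alpha by ring.
rewrite e1 in w1; rewrite e0 in w0; rewrite w1.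
have f0 := floor_itv (y + u%:~R * alpha - alpha); rewrite w0 intrD in f0.
have f1 := floor_itv (y + u%:~R * alpha); rewrite w1 intrD in f1.
have [res1 res2] := res u; have NS := class_heightS W S u.
case: (boolP (S (W u))) NS => Su NS.
  have N1 : class_height W S (u + 1) = class_height W S u + 1 by rewrite NS.
  have -> : y + u%:~R * alpha - (class_height W S (u + 1))%:~R < alpha.
    by rewrite N1 intrD; lra.
  by rewrite letter_red //; apply: rE => //; exact: res1.
have N1 : class_height W S (u + 1) = class_height W S u by rewrite NS addr0.
have -> : (y + u%:~R * alpha - (class_height W S (u + 1))%:~R < alpha) = false.
  by apply/negbTE; rewrite -leNgt N1; lra.
have S'u : S' (W u) by have := cover u; rewrite (negPf Su).
rewrite letter_blue //; apply: sE => //.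
have dvd_m : ((d (W u))%:Z %| m%:Z)%Z by apply: dm; rewrite S'u orbT.
have := rpredD (dvdz_trans dvd_m (iterz_component c0 u)) (res2 S'u).
set c := iterz _ _ _ _; set N := class_height _ _ _; set w := j _.
by have -> : c%:Z - c0%:Z - u + (u + 1 - N + w) = c%:Z + 1 - N + w by rewrite /=; ring.
Qed.
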